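(* Fix $n\in\mathbb{Z}$, and consider the problem of testing $H_0$ (the observation window contains only data) against $H_1$ (the observation window contains the synchronization word) from the post-processed received vector $$\mathbf{R}^{(P)}[n]=\big(\tilde{\mathbf{R}}[nM]^T,\tilde{\mathbf{R}}[nM-1]^T,\dots,\tilde{\mathbf{R}}[nM-(M-1)]^T\big)^T\in\mathbb{C}^{L_{sw}},$$ in the setting described in the context, with known channel impulse response $h$ and known noise autocorrelation $c_z$. For an observed value with blocks $\tilde{\mathbf{r}}[nM-m]\in\mathbb{C}^K$, $m=0,\dots,M-1$, the likelihood ratio is $$\frac{f(\mathbf{R}^{(P)}[n]\mid H_0)}{f(\mathbf{R}^{(P)}[n]\mid H_1)}=\frac{1}{N_s^{MK}}\cdot\frac{\displaystyle\sum_{l=0}^{N_s^{L_{tot}}-1}\exp\Big(-\sum_{m=0}^{M-1}\big(\tilde{\mathbf{r}}[nM-m]-\mathbb{B}\,\mathbf{a}_{q(l,m)}\big)^H\mathbb{C}_z^{-1}\big(\tilde{\mathbf{r}}[nM-m]-\mathbb{B}\,\mathbf{a}_{q(l,m)}\big)\Big)}{\displaystyle\sum_{u=0}^{N_s^{ML_{ch}}-1}\exp\Big(-\sum_{m=0}^{M-1}\big(\tilde{\mathbf{r}}[nM-m]-\mathbb{B}\,\tilde{\mathbf{a}}_{\tilde q(u,m),m}\big)^H\mathbb{C}_z^{-1}\big(\tilde{\mathbf{r}}[nM-m]-\mathbb{B}\,\tilde{\mathbf{a}}_{\tilde q(u,m),m}\big)\Big)},$$ where $f(\cdot\mid H_i)$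 is the probability density of $\mathbf{R}^{(P)}[n]$ under $H_i$ with respect to Lebesgue measure on $\mathbb{C}^{L_{sw}}$. Consequently, for every $\lambda>0$, the likelihood ratio test which decides $H_0$ when this ratio exceeds $\lambda$ and $H_1$ when it is below $\lambda$ is equivalent to comparing the natural logarithm of the quotient of the two sums above with $\log_e\big(\lambda\cdot N_s^{MK}\big)$ (deciding $H_0$ if larger, $H_1$ if smaller).
   Context: Channel. $h[m,l]\in\mathbb{C}$ ($m,l\in\mathbb{Z}$) is a deterministic periodically time-varying channel impulse response: $h[m+P_h,l]=h[m,l]$ for some $P_h\in\mathbb{N}$, and $h[m,l]=0$ for $l<0$ and for $l>L_h$, where $L_h\in\mathbb{N}$. The received signal is $R[m]=\sum_{l=0}^{L_{ch}}h[m,l]\,S[m-l]+Z[m]$, $m\in\mathbb{Z}$. Noise. $Z[m]$ is a zero-mean proper complex Gaussian process (jointly complex Gaussian, with $E\{Z[m+l]Z[m]\}=0$ for all $m,l$), with autocorrelation $c_z[m,l]=E\{Z[m+l]Z[m]^*\}$ satisfying $c_z[m+P_z,l]=c_z[m,l]$ for some $P_z\in\mathbb{N}$ and $c_z[m,l]=0$ whenever $|l|>L_z$, where $L_z\in\mathbb{N}$. Parameters. $L_{ch}=\max\{L_z,L_h\}$; $N$ is a common multiple of $P_h$ and $P_z$ with $N>L_{ch}$; $K=N-L_{ch}$; $M\in\mathbb{N}$; $L_{sw}=KM$, with $L_{sw}>L_{ch}+1$; $L_{tot}=NM$. Symbols. $\mathcal{S}=\{s_0,\dots,s_{N_s-1}\}\subset\mathbb{C}$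 is a finite constellation of $N_s$ distinct points. Data symbols are i.i.d. and uniform on $\mathcal{S}$, have zero mean, and are independent of the noise process $Z$. Synchronization word. It is a fixed known vector $\mathbf{f}_{sw}=(\mathbf{t}_{M-1}^T,\mathbf{t}_{M-2}^T,\dots,\mathbf{t}_0^T)^T\in\mathbb{C}^{L_{sw}}$ with blocks $\mathbf{t}_i\in\mathbb{C}^K$. Observation. For $k\in\mathbb{Z}$, $\tilde{\mathbf{R}}[k]=(R[kN],R[kN-1],\dots,R[kN-(K-1)])^T\in\mathbb{C}^K$ (of each length-$N$ block of received samples the last $L_{ch}$ are discarded). Hypotheses. For $m=0,\dots,M-1$, let $\mathbf{g}^{(m)}=(S[nL_{tot}-mN],S[nL_{tot}-mN-1],\dots,S[nL_{tot}-mN-(N-1)])^T\in\mathbb{C}^N$ be the transmitted symbols of the $m$-th block. Under $H_0$ all entries of all $\mathbf{g}^{(m)}$ are data symbols. Under $H_1$, for each $m$, the first $K$ entries of $\mathbf{g}^{(m)}$ form the vector $\mathbf{t}_{M-1-m}$, and the last $L_{ch}$ entries are data symbols. Channel matrix. $\mathbb{B}\in\mathbb{C}^{K\times N}$ has entries $[\mathbb{B}]_{a+1,c+1}=h[-a,c-a]$ if $0\le c-a\le L_{ch}$, and $0$ otherwise, for $a=0,\dots,K-1$, $c=0,\dots,N-1$. By periodicity, $\tilde{\mathbf{R}}[nM-m]=\mathbb{B}\,\mathbf{g}^{(m)}+(Z[(nM-m)N],\dots,Z[(nM-m)N-(K-1)])^T$. Noise matrix. $\mathbb{C}_z$ is the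 $K\times K$ matrix with entries $[\mathbb{C}_z]_{a_1+1,a_2+1}=c_z[-a_2,a_2-a_1]$, $a_1,a_2\in\{0,\dots,K-1\}$; it is assumed invertible. Enumerations. For $l=0,\dots,N_s^N-1$, $\mathbf{a}_l\in\mathbb{C}^N$ is the vector whose $(d+1)$-th entry is $s_{(\lfloor l/N_s^d\rfloor \bmod N_s)}$, $d=0,\dots,N-1$. For $l=0,\dots,N_s^{L_{ch}}-1$ and $k=0,\dots,M-1$, $\tilde{\mathbf{a}}_{l,k}\in\mathbb{C}^N$ is the vector whose first $K$ entries are $\mathbf{t}_{M-1-k}$ and whose $(K+d+1)$-th entry is $s_{(\lfloor l/N_s^d\rfloor \bmod N_s)}$, $d=0,\dots,L_{ch}-1$. Finally $q(l,m)=\lfloor l/N_s^{mN}\rfloor \bmod N_s^N$ and $\tilde q(u,m)=\lfloor u/N_s^{mL_{ch}}\rfloor \bmod N_s^{L_{ch}}$. Superscripts $T$, $H$, $*$ denote transpose, Hermitian transpose and complex conjugate. *)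

(* Defs.v *)
From HB Require Import structures.
From mathcomp Require Import all_boot all_order all_algebra.
From mathcomp Require Import all_classical all_reals all_analysis.
From mathcomp Require Import complex.

Set Implicit Arguments.
Unset Strict Implicit.
Unset Printing Implicit Defensive.

Import Order.TTheory GRing.Theory Num.Theory.
Import numFieldNormedType.Exports.

Local Open Scope classical_set_scope.
Local Open Scope ring_scope.

(* [R[i]] carries the sigma-algebra of [R * R]. *)
Section complex_measurable.
Variable R : realType.

HB.instance Definition _ := isPointed.Build R[i] (0 +i* 0)%C.

Definition complex_of_pair (p : R * R) : R[i] := (p.1 +i* p.2)%C.

Definition measurable_complex : set (set R[i]) :=
  [set A | measurable (complex_of_pair @^-1` A)].

Let measurable_complex0 : measurable_complex set0.
Proof. by rewrite /measurable_complex /= preimage_set0. Qed.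

Let measurable_complexC A : measurable_complex A -> measurable_complex (~` A).
Proof. by rewrite /measurable_complex /= preimage_setC; exact: measurableC. Qed.

Let measurable_complex_bigcup (F : (set R[i])^nat) :
  (forall i, measurable_complex (F i)) -> measurable_complex (\bigcup_i F i).
Proof.
rewrite /measurable_complex /= => mF; rewrite preimage_bigcup.
exact: bigcup_measurable.
Qed.

HB.instance Definition _ := @isMeasurable.Build default_measure_display
  R[i] measurable_complex
  measurable_complex0 measurable_complexC measurable_complex_bigcup.

Lemma measurable_complex_of_pair : measurable_fun setT complex_of_pair.
Proof. by move=> _ A mA; rewrite setTI. Qed.

Lemma measurable_Re : measurable_fun setT (@complex.Re R).
Proof.
move=> _ A mA; rewrite setTI.
have := @measurable_fst _ _ R R measurableT A mA; rewrite setTI.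
exact.
Qed.

Lemma measurable_Im : measurable_fun setT (@complex.Im R).
Proof.
move=> _ A mA; rewrite setTI.
have := @measurable_snd _ _ R R measurableT A mA; rewrite setTI.
exact.
Qed.

End complex_measurable.

(* Column vectors carry the product sigma-algebra. *)
Section vector_measurable.
Context {d} {T : measurableType d} {n : nat}.

Let coord (i : 'I_n) (v : 'cV[T]_n) : T := v i ord0.

Let vector_set0 : g_sigma_preimage coord set0.
Proof. exact: sigma_algebra0. Qed.

Let vector_setC A : g_sigma_preimage coord A -> g_sigma_preimage coord (~` A).
Proof. exact: sigma_algebraC. Qed.

Let vector_bigcup (F : _^nat) : (forall i, g_sigma_preimage coord (F i)) ->
  g_sigma_preimage coord (\bigcup_i (F i)).
Proof. exact: sigma_algebra_bigcup. Qed.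

HB.instance Definition _ := @isMeasurable.Build (measure_tuple_display d)
  'cV[T]_n (g_sigma_preimage coord) vector_set0 vector_setC vector_bigcup.

Lemma measurable_coord (i : 'I_n) :
  measurable_fun setT (fun v : 'cV[T]_n => v i ord0).
Proof.
move=> _ A mA; rewrite setTI; apply: sub_sigma_algebra.
rewrite (bigD1 i) //=; left; exists A => //; by rewrite setTI.
Qed.

Lemma measurable_to_cV d' (T' : measurableType d') (f : T' -> 'cV[T]_n) :
  (forall i, measurable_fun setT (fun x => f x i ord0)) -> measurable_fun setT f.
Proof.
move=> mf; apply: (@measurability _ _ _ _ _ _
  (\big[setU/set0]_(i < n) preimage_set_system setT (coord i) measurable)) => //.
move=> _ [B] /= + <-.
elim/big_ind : _ => //.
- move=> P Q hP hQ [] ; [exact: hP|exact: hQ].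
- move=> i _ [C mC <-].
  by rewrite setTI; exact: mf.
Qed.

End vector_measurable.

Section vector_cons.
Context {d} {T : measurableType d} {n : nat}.

Definition vcons (p : T * 'cV[T]_n) : 'cV[T]_n.+1 :=
  col_mx (const_mx p.1 : 'cV[T]_1) p.2.

Definition vuncons (v : 'cV[T]_n.+1) : T * 'cV[T]_n :=
  (v ord0 ord0, dsubmx (v : 'cV[T]_(1 + n))).

Lemma vconsK : cancel vcons vuncons.
Proof.
case=> x v; rewrite /vcons /vuncons /= col_mxKd; congr (_, _).
by rewrite mxE; case: splitP => // j _; rewrite mxE.
Qed.

Lemma measurable_vcons : measurable_fun setT vcons.
Proof.
apply: measurable_to_cV => i; rewrite /vcons.
case: (splitP (i : 'I_(1 + n))) => j ij.
- rewrite [X in measurable_fun _ X](_ : _ = fst); first exact: measurable_fst.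
  apply/funext => p; rewrite mxE; case: splitP => [k _|k]; first by rewrite mxE.
  by move=> ik; have := ltn_ord j; rewrite -ij ik.
- rewrite [X in measurable_fun _ X](_ : _ =
    (fun v : 'cV[T]_n => v j ord0) \o snd).
    by apply: measurableT_comp; [exact: measurable_coord|exact: measurable_snd].
  apply/funext => p; rewrite mxE; case: splitP => [k|k].
    by move=> ik; have := ltn_ord k; rewrite -ik ij.
  by rewrite ij => /addnI/ord_inj ->.
Qed.

Lemma measurable_vuncons : measurable_fun setT vuncons.
Proof.
apply/measurable_fun_pairP; split; first exact: measurable_coord.
apply: measurable_to_cV => i.
rewrite [X in measurable_fun _ X](_ : _ =
    fun v : 'cV[T]_n.+1 => v (rshift 1 i : 'I_n.+1) ord0).
  exact: measurable_coord.
by apply/funext => v /=; rewrite mxE.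
Qed.

HB.instance Definition _ :=
  isMeasurableFun.Build _ _ _ _ vcons measurable_vcons.

End vector_cons.

Section vector_cons_measure.
Context {d} {T : measurableType d} {R : realType} {n : nat}.
Local Open Scope ereal_scope.
Variables (mu : {sigma_finite_measure set T -> \bar R})
  (nu : {sigma_finite_measure set 'cV[T]_n -> \bar R}).

Definition vcons_measure : set 'cV[T]_n.+1 -> \bar R :=
  pushforward (mu \x nu) vcons.

Let vcons_measure0 : vcons_measure set0 = 0.
Proof. exact: measure0. Qed.

Let vcons_measure_ge0 A : 0 <= vcons_measure A.
Proof. exact: measure_ge0. Qed.

Let vcons_measure_sigma_additive : semi_sigma_additive vcons_measure.
Proof. exact: measure_semi_sigma_additive. Qed.

HB.instance Definition _ := isMeasure.Build _ _ _ vcons_measure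
  vcons_measure0 vcons_measure_ge0 vcons_measure_sigma_additive.

Let vcons_measure_sigma_finite : sigma_finite setT vcons_measure.
Proof.
have [F FT Foo] := sigma_finiteT mu; have [G GT Goo] := sigma_finiteT nu.
pose f k : nat * nat := odflt (0, 0)%N (unpickle k).
exists (fun k => vuncons @^-1` (F (f k).1 `*` G (f k).2)).
  rewrite -preimage_bigcup; apply/seteqP; split => // v _ /=.
  have [i _ Fi] : (\bigcup_i F i) (vuncons v).1 by rewrite -FT.
  have [j _ Gj] : (\bigcup_j G j) (vuncons v).2 by rewrite -GT.
  by exists (pickle (i, j)) => //=; rewrite /f pickleK.
move=> k; have [mF Foo1] := Foo (f k).1; have [mG Goo1] := Goo (f k).2; split.
  rewrite -[X in measurable X]setTI; apply: measurable_vuncons => //.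
  exact: measurableX.
rewrite /vcons_measure /pushforward (_ : vcons @^-1` _ = F (f k).1 `*` G (f k).2).
  by rewrite product_measure1E// lte_mul_pinfty// ge0_fin_numE.
by rewrite -comp_preimage (_ : vuncons \o vcons = id) //; apply/funext/vconsK.
Qed.

HB.instance Definition _ := Measure_isSigmaFinite.Build _ _ _ vcons_measure
  vcons_measure_sigma_finite.

End vector_cons_measure.

(* The [n]-fold product of [mu] with itself. *)
Fixpoint power_measure d (T : measurableType d) (R : realType)
    (mu : {sigma_finite_measure set T -> \bar R}) (n : nat) :
    {sigma_finite_measure set 'cV[T]_n -> \bar R} :=
  if n is k.+1 then vcons_measure mu (power_measure mu k)
  else \d_(const_mx point : 'cV[T]_0).

(* Lebesgue measure on [C^n], identified with [R^(2n)] by listing the real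
   parts before the imaginary parts. *)
Section complex_vectors.
Variables (R : realType) (n : nat).

Definition complex_cV (u : 'cV[R]_(n + n)) : 'cV[R[i]]_n :=
  \col_i (u (lshift n i) ord0 +i* u (rshift n i) ord0)%C.

Definition real_cV (v : 'cV[R[i]]_n) : 'cV[R]_(n + n) :=
  col_mx (map_mx (@complex.Re R) v) (map_mx (@complex.Im R) v).

Lemma complex_cVK : cancel complex_cV real_cV.
Proof.
move=> u; rewrite -[RHS]vsubmxK; congr col_mx; apply/colP => i; rewrite !mxE //=.
Qed.

Lemma real_cVK : cancel real_cV complex_cV.
Proof.
by move=> v; apply/colP => i; rewrite mxE col_mxEu col_mxEd !mxE; case: (v i _).
Qed.

Lemma measurable_complex_cV :
  measurable_fun [set: 'cV[measurableTypeR R]_(n + n)] complex_cV.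
Proof.
apply: measurable_to_cV => i.
rewrite [X in measurable_fun _ X](_ : _ = @complex_of_pair R \o
  (fun u : 'cV[measurableTypeR R]_(n + n) =>
    (u (lshift n i) ord0, u (rshift n i) ord0))).
  apply: measurableT_comp; first exact: measurable_complex_of_pair.
  by apply: measurable_fun_pair; exact: measurable_coord.
by apply/funext => u; rewrite /= mxE.
Qed.

Local Open Scope ereal_scope.

Definition lebesgue_cV : set 'cV[R[i]]_n -> \bar R :=
  pushforward (power_measure (@lebesgue_measure R) (n + n)) complex_cV.

Let measurable_preimage (A : set 'cV[R[i]]_n) : measurable A ->
  measurable (complex_cV @^-1` A : set 'cV[measurableTypeR R]_(n + n)).
Proof.
by move=> mA; rewrite -[X in measurable X]setTI; exact: measurable_complex_cV.
Qed.

Let lebesgue_cV0 : lebesgue_cV set0 = 0.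
Proof. by rewrite /lebesgue_cV /pushforward preimage_set0 measure0. Qed.

Let lebesgue_cV_ge0 A : 0 <= lebesgue_cV A.
Proof.
exact: (measure_ge0 (power_measure (@lebesgue_measure R) (n + n))).
Qed.

Let lebesgue_cV_sigma_additive : semi_sigma_additive lebesgue_cV.
Proof.
move=> F mF tF mUF; rewrite /lebesgue_cV /pushforward preimage_bigcup.
apply: (@measure_semi_sigma_additive _ _ _
  (power_measure (@lebesgue_measure R) (n + n)) (fun k => complex_cV @^-1` F k)).
- by move=> k; exact: measurable_preimage.
- apply/trivIsetP => /= i j _ _ ij; rewrite -preimage_setI.
  by move/trivIsetP : tF => /(_ _ _ _ _ ij) ->//; rewrite preimage_set0.
- by rewrite -preimage_bigcup; exact: measurable_preimage.
Qed.

HB.instance Definition _ := isMeasure.Build _ _ _ lebesgue_cV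
  lebesgue_cV0 lebesgue_cV_ge0 lebesgue_cV_sigma_additive.

End complex_vectors.
Arguments lebesgue_cV : clear implicits.

Section probability_notions.
Context {d} {Omega : measurableType d} {R : realType}.
Variable P : probability Omega R.

Definition expectation_complex (X : Omega -> R[i]) : R[i] :=
  ((\int[P]_w complex.Re (X w)) +i* (\int[P]_w complex.Im (X w)))%C.

Definition is_density n (X : Omega -> 'cV[R[i]]_n) (f : 'cV[R[i]]_n -> R) :=
  [/\ measurable_fun setT f, forall r, 0 <= f r &
      forall A, measurable A ->
        P (X @^-1` A) = (\int[lebesgue_cV R n]_(r in A) (f r)%:E)%E].

(* Jointly Gaussian real and imaginary parts: the law of an affine image of
   independent standard normal variables. Degenerate laws are allowed.
   [normal_prob] lives on [measurableTypeR R], which is convertible to [R] but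
   carries another instance of the Borel sigma-algebra. *)
Definition gaussian_cV n (X : Omega -> 'cV[R[i]]_n) :=
  exists (k : nat) (A : 'M[R]_(n + n, k)) (b : 'cV[R]_(n + n)),
    forall B : set 'cV[R]_(n + n), measurable B ->
      P [set w | B (real_cV (X w))] =
      power_measure (@normal_prob R 0 1) k
        [set u : 'cV[measurableTypeR R]_k | B (A *m (u : 'cV[R]_k) + b)].

Definition gaussian_process (Z : int -> Omega -> R[i]) :=
  forall (n : nat) (t : 'I_n -> int), gaussian_cV (fun w => \col_i Z (t i) w).

Definition mutually_independent (D : set int) (X : int -> Omega -> R[i]) :=
  forall (ks : seq int) (B : int -> set R[i]),
    uniq ks -> (forall k, k \in ks -> D k) -> (forall k, measurable (B k)) ->
    P (\bigcap_(k in [set` ks]) (X k @^-1` B k)) =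
    (\prod_(k <- ks) P (X k @^-1` B k))%E.

Definition generated_sigma_algebra (D : set int) (X : int -> Omega -> R[i]) :
    set (set Omega) :=
  <<s \bigcup_(k in D) preimage_set_system setT (X k) measurable >>.

Definition independent_sigma_algebras (F G : set (set Omega)) :=
  forall A B, F A -> G B -> P (A `&` B) = (P A * P B)%E.

Record proper_gaussian_noise (cz : int -> int -> R[i])
    (Z : int -> Omega -> R[i]) : Prop := ProperGaussianNoise {
  noise_gaussian : gaussian_process Z;
  noise_mean : forall m, expectation_complex (Z m) = 0;
  noise_proper : forall m l,
    expectation_complex (fun w => Z (m + l) w * Z m w) = 0;
  noise_autocorrelation : forall m l,
    expectation_complex (fun w => Z (m + l) w * (Z m w)^*) = cz m l }.

Record data_symbols (s : seq R[i]) (D : set int) (S Z : int -> Omega -> R[i]) :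
    Prop := DataSymbols {
  data_independent : mutually_independent D S;
  data_uniform : forall k x, D k -> x \in s ->
    P (S k @^-1` [set x]) = ((size s)%:R^-1)%:E;
  data_mean : forall k, D k -> expectation_complex (S k) = 0;
  data_noise_independent : independent_sigma_algebras
    (generated_sigma_algebra D S) (generated_sigma_algebra setT Z) }.

End probability_notions.

Section blocks.
Variables (C : Type) (M K : nat).

(* [mxvec] lists the entries row by row, so the blocks are stacked in order. *)
Definition stack (b : 'I_M -> 'cV[C]_K) : 'cV[C]_(M * K) :=
  (mxvec (\matrix_(m < M, a < K) b m a ord0))^T.

Definition block (v : 'cV[C]_(M * K)) (m : 'I_M) : 'cV[C]_K :=
  (row m (vec_mx v^T))^T.

Lemma stackK b m : block (stack b) m = b m.
Proof. by apply/colP => a; rewrite /block /stack trmxK mxvecK !mxE. Qed.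

End blocks.

Section model.
Context {d} {Omega : measurableType d} {R : realType}.
Local Notation C := R[i].
Variables (N M K Lch : nat) (n : int).

(* Entry [j] of the vector g^(m) is the symbol at this time. *)
Definition symbol_time (m j : nat) : int :=
  n * (N * M)%:Z - (m * N)%:Z - j%:Z.

Definition received (h : int -> int -> C) (S Z : int -> Omega -> C)
    (m : int) (w : Omega) : C :=
  \sum_(l < Lch.+1) h m l%:Z * S (m - l%:Z) w + Z m w.

Definition received_block h S Z (k : int) (w : Omega) : 'cV[C]_K :=
  \col_(a < K) received h S Z (k * N%:Z - a%:Z) w.

Definition post_processed h S Z (w : Omega) : 'cV[C]_(M * K) :=
  stack (fun m : 'I_M => received_block h S Z (n * M%:Z - m%:Z) w).

(* The block [t_i] of the synchronization word [(t_(M-1), ..., t_0)]. *)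
Definition sync_block (fsw : 'cV[C]_(M * K)) (i : 'I_M) : 'cV[C]_K :=
  block fsw (rev_ord i).

Definition data_hypothesis (P : probability Omega R) (s : seq C) S Z :=
  data_symbols P s
    [set k | exists (m : 'I_M) (j : 'I_N), k = symbol_time m j] S Z.

Definition sync_hypothesis (P : probability Omega R) (s : seq C)
    (fsw : 'cV[C]_(M * K)) (S Z : int -> Omega -> C) :=
  (forall (m : 'I_M) (a : 'I_K),
     {ae P, forall w, S (symbol_time m a) w =
                      sync_block fsw (rev_ord m) a ord0}) /\
  data_symbols P s
    [set k | exists (m : 'I_M) (j : 'I_Lch), k = symbol_time m (K + j)] S Z.

Definition channel_matrix (h : int -> int -> C) : 'M[C]_(K, N) :=
  \matrix_(a < K, c < N)
    if (a <= c <= a + Lch)%N then h (- a%:Z) (c%:Z - a%:Z) else 0.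

Definition noise_matrix (cz : int -> int -> C) : 'M[C]_K :=
  \matrix_(a1 < K, a2 < K) cz (- a2%:Z) (a2%:Z - a1%:Z).

Section enumerations.
Variable s : seq C.
Let Ns := size s.

Definition data_vector (l : nat) : 'cV[C]_N :=
  \col_(e < N) s`_(l %/ Ns ^ e %% Ns).

Definition sync_vector (fsw : 'cV[C]_(M * K)) (l : nat) (k : 'I_M) : 'cV[C]_N :=
  \col_(e < N)
    if insub (e : nat) is Some a then sync_block fsw (rev_ord k) (a : 'I_K) ord0
    else s`_(l %/ Ns ^ (e - K) %% Ns).

Definition data_index (l m : nat) : nat := l %/ Ns ^ (m * N) %% Ns ^ N.

Definition sync_index (u m : nat) : nat := u %/ Ns ^ (m * Lch) %% Ns ^ Lch.

End enumerations.

(* [v^H A^-1 v], which is real when [A] is Hermitian; the sums below take its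
   real part in order to apply the real exponential. *)
Definition inverse_form (A : 'M[C]_K) (v : 'cV[C]_K) : C :=
  ((map_mx Num.conj v)^T *m invmx A *m v) ord0 ord0.

Definition data_sum (s : seq C) (h cz : int -> int -> C)
    (r : 'cV[C]_(M * K)) : R :=
  \sum_(l < size s ^ (N * M))
    expR (- \sum_(m < M) complex.Re (inverse_form (noise_matrix cz)
      (block r m - channel_matrix h *m data_vector s (data_index s l m)))).

Definition sync_sum (s : seq C) (h cz : int -> int -> C)
    (fsw r : 'cV[C]_(M * K)) : R :=
  \sum_(u < size s ^ (M * Lch))
    expR (- \sum_(m < M) complex.Re (inverse_form (noise_matrix cz)
      (block r m -
       channel_matrix h *m sync_vector s fsw (sync_index s u m) m))).

End model.

(* Main.v *)
(** The noise at the retained sampling times is a proper Gaussian vector whose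
    covariance is block diagonal, with [M] blocks equal to the noise matrix:
    distinct blocks are separated by more than [Lz] samples. Its law is the image
    of a standard Gaussian vector under a matrix [A], so it has a density
    proportional to [exp (- 1/2 y^T (A A^T)^-1 y)], and properness turns this
    exponent into the sum of the complex forms [v^H C_z^-1 v] of the blocks.
    Conditioning on the transmitted data, which take equally likely values
    independent of the noise, the received vector is a translate of the noise;
    its density is therefore an average of translated noise densities over
    [Ns ^ (M N)] configurations under [H_0] and over [Ns ^ (M L_ch)] under [H_1].
    The normalization of the noise density cancels in the quotient, and the
    numbers of configurations leave the factor [Ns ^ (- M K)]. *)

Require Import Defs.
From HB Require Import structures.
From mathcomp Require Import all_boot all_order all_algebra.
From mathcomp Require Import all_classical all_reals all_analysis.
From mathcomp Require Import measurable_realfun complex ring lra zify.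

Set Implicit Arguments.
Unset Strict Implicit.
Unset Printing Implicit Defensive.

Import Order.TTheory GRing.Theory Num.Theory.

Local Open Scope classical_set_scope.
Local Open Scope ring_scope.

(** * Product measures on column vectors *)

(** The Gaussian hypothesis presents the noise only as an image [A u + b] of a standard normal
    vector, with [A] of any width and possibly degenerate, while the covariance is known only
    through expectations. Hence [A *m A^T] must be recovered from second moments before it can be
    seen to be invertible. Moments of products come from integrals of squares by polarization, so
    that Tonelli and the transfer of laws are applied to nonnegative functions only.

    No determinant or normalizing Gaussian integral is evaluated: the constants in the changes of
    variables stay abstract, possibly infinite, until total mass one pins them down.

    Both hypotheses are instances of one mixture computation, in which the data occupy the positions
    [off, ..., off + w - 1] of every block: [off = 0] and [w = N] under [H_0], [off = K] and
    [w = Lch] under [H_1]. *)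

Section power_measure_integral.
Local Open Scope ereal_scope.
Context d (T : measurableType d) (R : realType).
Variable mu : {sigma_finite_measure set T -> \bar R}.

(** Tonelli on the recursive definition of [power_measure]; this is the induction step on the
    dimension in what follows. *)
Lemma ge0_integral_power_measureS n (f : 'cV[T]_n.+1 -> \bar R) :
  measurable_fun setT f -> (forall v, 0 <= f v) ->
  \int[power_measure mu n.+1]_v f v =
  \int[mu]_x \int[power_measure mu n]_v f (vcons (x, v)).
Proof.
move=> mf f0.
transitivity (\int[pushforward (mu \x power_measure mu n)
    (@vcons _ T n : _ -> _)]_v f v); first by [].
rewrite (@ge0_integral_pushforward _ _ _ _ R (@vcons _ T n)
  (@measurable_vcons _ T n) (mu \x power_measure mu n) setT f) //=.
rewrite preimage_setT fubini_tonelli1 //=.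
by apply: measurableT_comp => //; exact: measurable_vcons.
Qed.

Lemma ge0_integral_power_measure0 (f : 'cV[T]_0 -> \bar R) :
  measurable_fun setT f -> (forall v, 0 <= f v) ->
  \int[power_measure mu 0]_v f v = f (const_mx point).
Proof. by move=> mf f0; rewrite /= integral_dirac// diracT mul1e. Qed.

Lemma vcons0 n (x : T) (v : 'cV[T]_n) : vcons (x, v) ord0 ord0 = x.
Proof. by have := vconsK (x, v); rewrite /vuncons => -[]. Qed.

Lemma vcons_lift n (x : T) (v : 'cV[T]_n) i :
  vcons (x, v) (lift ord0 i) ord0 = v i ord0.
Proof.
have -> : lift ord0 i = rshift 1 i :> 'I_(1 + n) by exact/val_inj.
exact: (@col_mxEd T 1 n 1 (const_mx x) v i ord0).
Qed.

Lemma measurable_vcons_curry n (f : 'cV[T]_n.+1 -> \bar R) (x : T) :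
  measurable_fun setT f -> measurable_fun setT (fun v => f (vcons (x, v))).
Proof.
move=> mf; apply: (measurableT_comp mf).
exact: (measurableT_comp (@measurable_vcons _ T n)).
Qed.

Lemma measurable_integral_vcons n (f : 'cV[T]_n.+1 -> \bar R) :
  measurable_fun setT f -> (forall v, 0 <= f v) ->
  measurable_fun setT (fun x => \int[power_measure mu n]_v f (vcons (x, v))).
Proof.
move=> mf f0; apply: (measurable_fun_fubini_tonelli_F (f \o vcons)).
  exact: (measurableT_comp mf (@measurable_vcons _ T n)).
by move=> x; exact: f0.
Qed.

End power_measure_integral.

Section power_measure_density.
Local Open Scope ereal_scope.
Context d (T : measurableType d) (R : realType).
Variables (mu nu : {sigma_finite_measure set T -> \bar R}) (f : T -> R).
Hypotheses (mf : measurable_fun setT f) (f0 : forall x, (0 <= f x)%R).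
Hypothesis nuE : forall F : T -> \bar R, measurable_fun setT F ->
  (forall x, 0 <= F x) -> \int[nu]_x F x = \int[mu]_x (F x * (f x)%:E).

Lemma measurable_prod_coord n :
  measurable_fun setT (fun v : 'cV[T]_n => \prod_i f (v i ord0))%R.
Proof.
apply: measurable_prod => i _.
exact: (measurableT_comp mf (measurable_coord _)).
Qed.

(** One coordinate at a time, [nu] is traded for [mu] with weight [f], and the weights multiply
    up. *)
Lemma ge0_integral_power_density n (F : 'cV[T]_n -> \bar R) :
  measurable_fun setT F -> (forall v, 0 <= F v) ->
  \int[power_measure nu n]_v F v =
  \int[power_measure mu n]_v (F v * (\prod_i f (v i ord0))%:E).
Proof.
elim: n F => [|n IH] F mF F0.
  rewrite !ge0_integral_power_measure0 //.
  - by rewrite big_ord0 mule1.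
  - by apply: emeasurable_funM => //; apply/measurable_EFinP;
      exact: measurable_prod_coord.
  - by move=> v; rewrite mule_ge0// lee_fin prodr_ge0.
rewrite !ge0_integral_power_measureS //; last 2 first.
- by apply: emeasurable_funM => //; apply/measurable_EFinP;
    exact: measurable_prod_coord.
- by move=> v; rewrite mule_ge0// lee_fin prodr_ge0.
rewrite nuE; last 2 first.
- exact: measurable_integral_vcons.
- by move=> x; apply: integral_ge0.
apply: eq_integral => x _.
rewrite IH //; last exact: measurable_vcons_curry.
rewrite -ge0_integralZr//=.
- apply: eq_integral => v _; rewrite big_ord_recl vcons0.
  under [in RHS]eq_bigr do rewrite vcons_lift.
  by rewrite EFinM -muleA (muleC (f x)%:E).
- apply: emeasurable_funM; first exact: measurable_vcons_curry.
  by apply/measurable_EFinP; exact: measurable_prod_coord.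
- by move=> v _; rewrite mule_ge0// lee_fin prodr_ge0.
- by rewrite lee_fin.
Qed.

End power_measure_density.

Section power_measure_split.
Local Open Scope ereal_scope.
Context d (T : measurableType d) (R : realType).
Variables (mu : {sigma_finite_measure set T -> \bar R}).

Lemma measurable_col_mx p q d' (T' : measurableType d')
  (f : T' -> 'cV[T]_p) (g : T' -> 'cV[T]_q) :
  measurable_fun setT f -> measurable_fun setT g ->
  measurable_fun setT (fun x => col_mx (f x) (g x)).
Proof.
move=> mf mg; apply: measurable_to_cV => i.
rewrite -(splitK i); case: (fintype.split i) => j /=.
  under eq_fun do rewrite col_mxEu.
  exact: (measurableT_comp (measurable_coord _) mf).
under eq_fun do rewrite col_mxEd.
exact: (measurableT_comp (measurable_coord _) mg).
Qed.

Lemma col_mx_vcons p q x (u : 'cV[T]_p) (v : 'cV[T]_q) :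
  col_mx (vcons (x, u)) v = vcons (x, col_mx u v) :> 'cV[T]_(p.+1 + q).
Proof.
apply/colP => i.
case: (unliftP (ord0 : 'I_(p + q).+1) i) => [j|] ->; last first.
  rewrite vcons0.
  have -> : ord0 = lshift q (ord0 : 'I_p.+1) :> 'I_(p.+1 + q) by exact/val_inj.
  by rewrite col_mxEu vcons0.
rewrite vcons_lift -(splitK j); case: (fintype.split j) => k /=.
  have -> : lift ord0 (lshift q k) = lshift q (lift ord0 k) :> 'I_(p.+1 + q).
    exact/val_inj.
  by rewrite !col_mxEu vcons_lift.
have -> : lift ord0 (rshift p k) = rshift p.+1 k :> 'I_(p.+1 + q).
  exact/val_inj.
by rewrite !col_mxEd.
Qed.

(** Lets a group of complementary coordinates be integrated out at once. *)
Lemma ge0_integral_power_measureD p q (F : 'cV[T]_(p + q) -> \bar R) :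
  measurable_fun setT F -> (forall v, 0 <= F v) ->
  \int[power_measure mu (p + q)]_v F v =
  \int[power_measure mu p]_u \int[power_measure mu q]_v F (col_mx u v).
Proof.
elim: p F => [|p IH] F mF F0.
  rewrite ge0_integral_power_measure0.
  - apply: eq_integral => v _; congr F; apply/colP => i.
    have -> : i = rshift 0 i by exact/val_inj.
    by rewrite col_mxEd; congr (v _ _); exact/val_inj.
  - apply: (measurable_fun_fubini_tonelli_F (fun uv => F (col_mx uv.1 uv.2))) =>
      //.
    by apply: (measurableT_comp mF); apply: measurable_col_mx.
  - by move=> u; apply: integral_ge0.
(* The ascription works because [p.+1 + q] and [(p + q).+1] are convertible. *)
rewrite (ge0_integral_power_measureS _
  (mF : measurable_fun setT (F : 'cV_(p + q).+1 -> _))) //.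
rewrite ge0_integral_power_measureS; last 2 first.
- apply: (measurable_fun_fubini_tonelli_F (fun uv => F (col_mx uv.1 uv.2))) =>
    //.
  by apply: (measurableT_comp mF); apply: measurable_col_mx.
- by move=> u; apply: integral_ge0.
apply: eq_integral => x _.
rewrite (IH (fun w => F (vcons (x, w)))) => [||v]; last exact: F0.
  by apply: eq_integral => u _; apply: eq_integral => v _; rewrite col_mx_vcons.
exact: (@measurable_vcons_curry _ T R (p + q) F).
Qed.

End power_measure_split.

(** * Lebesgue measure under translations and linear maps *)

Section lebesgue_translation.
Local Open Scope ereal_scope.
Context (R : realType).
Notation TR := (measurableTypeR R).
Notation mu := (@lebesgue_measure R).

(** Lebesgue measure is the only measure giving each []b, c]] its length, and a shift preserves
    lengths. *)
Lemma lebesgue_measureD (a : R) (A : set R) : measurable A ->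
  pushforward mu (fun x : R => x + a : TR)%R A = mu A.
Proof.
move=> mA; apply/esym.
have ma : measurable_fun [set: TR] (fun x : R => x + a : TR)%R.
  exact: measurable_funD.
pose f : {mfun TR >-> TR} :=
  HB.pack (fun x : R => x + a : TR)%R (isMeasurableFun.Build _ _ _ _ _ ma).
apply: (@lebesgue_measure_unique R (pushforward mu f)) => //= _ [[b c]] _ <-.
rewrite /pushforward.
rewrite (_ : _ @^-1` _ = `]b - a, c - a]%classic)%R; last first.
  by apply/seteqP; split=> x /=; rewrite !in_itv /= ltrBlDr lerBrDr.
rewrite !lebesgue_measure_itv/= !lte_fin ltrD2r.
by case: ifP => // _; rewrite -!EFinB; congr EFin; ring.
Qed.

Lemma ge0_integral_lebesgueD (F : TR -> \bar R) (a : R) :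
  measurable_fun setT F -> (forall x, 0 <= F x) ->
  \int[mu]_x F (x + a)%R = \int[mu]_x F x.
Proof.
move=> mF F0.
have ma : measurable_fun [set: TR] (fun x : R => x + a : TR)%R.
  exact: measurable_funD.
rewrite -[RHS](@eq_measure_integral _ _ _ _ mu
  (pushforward mu (fun x : R => x + a : TR)%R)).
  by rewrite (ge0_integral_pushforward ma)// preimage_setT.
by move=> A mA _; exact: lebesgue_measureD.
Qed.

End lebesgue_translation.

Section linear_measurable.
Context (R : realType).
Notation TR := (measurableTypeR R).

Lemma measurable_cV_addr n (a : 'cV[R]_n) :
  measurable_fun [set: 'cV[TR]_n]
    (fun v : 'cV[TR]_n => (v : 'cV[R]_n) + a : 'cV[TR]_n).
Proof.
apply: measurable_to_cV => i; under eq_fun do rewrite mxE.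
by apply: measurable_funD => //; exact: measurable_coord.
Qed.

Lemma measurable_mulmx_cV m n (A : 'M[R]_(m, n)) :
  measurable_fun [set: 'cV[TR]_n]
    (fun v : 'cV[TR]_n => A *m (v : 'cV[R]_n) : 'cV[TR]_m).
Proof.
apply: measurable_to_cV => i; under eq_fun do rewrite mxE.
apply: measurable_sum => j; apply: measurable_funM => //.
exact: measurable_coord.
Qed.

Lemma measurable_quad_form n (A : 'M[R]_n) :
  measurable_fun [set: 'cV[TR]_n]
    (fun v : 'cV[TR]_n => ((v : 'cV[R]_n)^T *m A *m (v : 'cV[R]_n)) ord0 ord0 :
      TR).
Proof.
under eq_fun do rewrite -mulmxA mxE.
apply: measurable_sum => j; apply: measurable_funM.
  under eq_fun do rewrite mxE.
  exact: measurable_coord.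
exact: (measurableT_comp (measurable_coord _) (measurable_mulmx_cV A)).
Qed.

End linear_measurable.

Section power_lebesgue_translation.
Local Open Scope ereal_scope.
Context (R : realType).
Notation TR := (measurableTypeR R).
Notation mu := (@lebesgue_measure R).

Lemma vcons_addr n (x : R) (v : 'cV[R]_n) (a : 'cV[R]_n.+1) :
  (vcons (x, v) + a = vcons (x + a ord0 ord0, v + \col_i a (lift ord0 i)
    ord0))%R.
Proof.
apply/colP => i; rewrite mxE.
case: (unliftP ord0 i) => [j|] ->; first by rewrite !vcons_lift !mxE.
by rewrite !vcons0.
Qed.

Lemma ge0_integral_power_lebesgueD n (F : 'cV[TR]_n -> \bar R) (a : 'cV[R]_n) :
  measurable_fun setT F -> (forall x, 0 <= F x) ->
  \int[power_measure mu n]_v F ((v : 'cV[R]_n) + a)%R =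
    \int[power_measure mu n]_v F v.
Proof.
elim: n F a => [|n IH] F a mF F0.
  by apply: eq_integral => v _; congr F; apply/colP => -[].
have mFa : measurable_fun [set: 'cV[TR]_n.+1]
  (fun v : 'cV[TR]_n.+1 => F ((v : 'cV[R]_n.+1) + a)%R).
  exact: (measurableT_comp mF (measurable_cV_addr a)).
rewrite (ge0_integral_power_measureS _ mF F0)
  (ge0_integral_power_measureS _ mFa) => [|v]; last exact: F0.
under eq_integral => x _ do under eq_integral => v _ do rewrite vcons_addr.
transitivity (\int[mu]_x \int[power_measure mu n]_v F
  (vcons ((x + a ord0 ord0)%R : TR, v))).
  apply: eq_integral => x _.
  apply: (IH (fun v => F (vcons ((x + a ord0 ord0)%R : TR, v)))) => //.
  exact: (@measurable_vcons_curry _ TR R).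
apply: (ge0_integral_lebesgueD
  (F := fun x => \int[power_measure mu n]_v F (vcons (x, v)))).
  exact: measurable_integral_vcons.
by move=> x; apply: integral_ge0.
Qed.

End power_lebesgue_translation.

(** * Integration against a density known on sets *)

Section finite_density.
Local Open Scope ereal_scope.
Context d (T : measurableType d) (R : realType).
Variables (nu : {finite_measure set T -> \bar R})
  (mu : {sigma_finite_measure set T -> \bar R}) (f : T -> R).
Hypotheses (mf : measurable_fun setT f) (f0 : forall x, (0 <= f x)%R).
Hypothesis nuE : forall A, measurable A -> nu A = \int[mu]_(x in A) (f x)%:E.

(** The hypothesis makes [nu] absolutely continuous, and its Radon-Nikodym derivative agrees with
    [f] almost everywhere because both have the same integral over every measurable set. *)
Lemma ge0_integral_finite_density (F : T -> \bar R) :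
  measurable_fun setT F -> (forall x, 0 <= F x) ->
  \int[nu]_x F x = \int[mu]_x (F x * (f x)%:E).
Proof.
move=> mF F0.
have numu : nu `<< mu.
  apply/null_content_dominatesP => A mA muA0; rewrite nuE //.
  by apply: null_set_integral => //; exact/measurable_EFinP/measurable_funTS.
rewrite -(Radon_Nikodym_SigmaFinite.change_of_variables numu F0) //.
apply: ge0_ae_eq_integral => //.
- apply: emeasurable_funM => //.
  exact: measurable_int (Radon_Nikodym_SigmaFinite.f_integrable numu).
- by apply: emeasurable_funM => //; exact/measurable_EFinP.
- by move=> x _; rewrite mule_ge0// Radon_Nikodym_SigmaFinite.f_ge0.
- by move=> x _; rewrite mule_ge0// lee_fin.
apply: ae_eqe_mul2l; apply: integral_ae_eq => //.
- exact: Radon_Nikodym_SigmaFinite.f_integrable.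
- exact/measurable_EFinP.
- by move=> A _ mA; rewrite -nuE// -Radon_Nikodym_SigmaFinite.f_integral.
Qed.

End finite_density.

Section linear_change.
Local Open Scope ereal_scope.
Context (R : realType).
Notation TR := (measurableTypeR R).
Notation mu := (@lebesgue_measure R).
Notation gamma := (@normal_prob R 0 1).

Lemma ge0_integral_normal_prob (F : TR -> \bar R) :
  measurable_fun setT F -> (forall x, 0 <= F x) ->
  \int[gamma]_x F x = \int[mu]_x (F x * (normal_pdf 0 1 x)%:E).
Proof.
apply: ge0_integral_finite_density => //.
- exact: measurable_normal_pdf.
- by move=> x; exact: normal_pdf_ge0.
Qed.

Lemma integral_power_normal_prob1 n : \int[power_measure gamma n]_v 1 = 1.
Proof.
elim: n => [|n IH]; first by rewrite ge0_integral_power_measure0.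
rewrite ge0_integral_power_measureS //.
under eq_integral do rewrite IH.
rewrite (integral_cst gamma measurableT 1) mul1e.
exact: (@probability_setT _ _ _ gamma).
Qed.

(* Both sides are translation-invariant functionals of [F], hence proportional:
   integrate [F (A x) g(y)] over [x] and [y] with [g] of mass one and translate
   twice.  This gives the change of variables without computing the constant,
   which is all that is needed of a density. *)
Lemma ge0_integral_mulmx n (A : 'M[R]_n) : A \in unitmx ->
  exists2 c : \bar R, 0 <= c & forall F : 'cV[TR]_n -> \bar R,
    measurable_fun setT F -> (forall v, 0 <= F v) ->
    \int[power_measure mu n]_v F (A *m (v : 'cV[R]_n))%R =
    c * \int[power_measure mu n]_v F v.
Proof.
move=> Au.
pose g (v : 'cV[TR]_n) : R := (\prod_i normal_pdf 0 1 (v i ord0))%R.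
have g0 v : (0 <= g v)%R by apply: prodr_ge0 => i _; exact: normal_pdf_ge0.
have mg : measurable_fun setT g.
  by apply: measurable_prod_coord; exact: measurable_normal_pdf.
have mEg : measurable_fun setT (EFin \o g) by exact/measurable_EFinP.
have int_g : \int[power_measure mu n]_v (g v)%:E = 1.
  rewrite -(integral_power_normal_prob1 n).
  rewrite (ge0_integral_power_density (mu := mu) (measurable_normal_pdf 0 1)
    (normal_pdf_ge0 0 1) ge0_integral_normal_prob (F := fun=> 1)) //.
  by apply: eq_integral => v _; rewrite mul1e.
(* The integral of [g (y - A x)] over [x]; translating [x] by [A^-1 y] shows that it is the same for
   all [y]. *)
pose c := \int[power_measure mu n]_v (g (- (A *m (v : 'cV[R]_n)))%R)%:E.
exists c => [|F mF F0].
  by apply: integral_ge0 => v _; rewrite lee_fin.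
have mA := measurable_mulmx_cV A.
have mFA : measurable_fun [set: 'cV[TR]_n]
  (fun v : 'cV[TR]_n => F (A *m (v : 'cV[R]_n))%R).
  exact: (measurableT_comp mF mA).
have madd : measurable_fun [set: 'cV[TR]_n * 'cV[TR]_n]
    (fun xy => ((A *m (xy.1 : 'cV[R]_n) + (xy.2 : 'cV[R]_n))%R : 'cV[TR]_n)).
  apply: measurable_to_cV => i; under eq_fun do rewrite mxE.
  apply: measurable_funD.
    exact: (measurableT_comp (measurable_coord i)
      (measurableT_comp mA measurable_fst)).
  exact: (measurableT_comp (measurable_coord i) measurable_snd).
have msub : measurable_fun [set: 'cV[TR]_n * 'cV[TR]_n]
    (fun xy => (((xy.2 : 'cV[R]_n) - A *m (xy.1 : 'cV[R]_n))%R : 'cV[TR]_n)).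
  apply: measurable_to_cV => i; under eq_fun do rewrite mxE.
  apply: measurable_funD.
    exact: (measurableT_comp (measurable_coord i) measurable_snd).
  under eq_fun do rewrite mxE.
  apply: measurable_funN.
  exact: (measurableT_comp (measurable_coord i)
    (measurableT_comp mA measurable_fst)).
transitivity (\int[power_measure mu n]_x \int[power_measure mu n]_y
    (F (A *m (x : 'cV[R]_n) + (y : 'cV[R]_n))%R * (g y)%:E)).
  rewrite (fubini_tonelli (fun xy : 'cV[TR]_n * 'cV[TR]_n =>
    F (A *m (xy.1 : 'cV[R]_n) + (xy.2 : 'cV[R]_n))%R * (g xy.2)%:E)) //=;
      last 2 first.
  - apply: emeasurable_funM; first exact: (measurableT_comp mF madd).
    exact: (measurableT_comp mEg measurable_snd).
  - by move=> x; rewrite mule_ge0 // lee_fin.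
  rewrite -[LHS]mule1 -int_g -ge0_integralZl //; last 2 first.
  - by move=> x _; rewrite lee_fin.
  - by apply: integral_ge0.
  apply: eq_integral => y _; rewrite ge0_integralZr//; last 2 first.
  - apply: (measurableT_comp mF).
    exact: (measurableT_comp (measurable_cV_addr _) mA).
  - by rewrite lee_fin.
  congr (_ * _).
  rewrite -(ge0_integral_power_lebesgueD (invmx A *m (y : 'cV[R]_n))%R mFA) //.
  by apply: eq_integral => x _; rewrite mulmxDr mulKVmx.
transitivity (\int[power_measure mu n]_x \int[power_measure mu n]_y
    (F y * (g ((y : 'cV[R]_n) - A *m (x : 'cV[R]_n))%R)%:E)).
  apply: eq_integral => x _.
  rewrite -(ge0_integral_power_lebesgueD (F := fun y : 'cV[TR]_n => F y *
    (g ((y : 'cV[R]_n) - A *m (x : 'cV[R]_n))%R)%:E) (A *m (x : 'cV[R]_n))%R);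
      last 2 first.
  - apply: emeasurable_funM => //.
    exact: (measurableT_comp mEg (measurable_cV_addr _)).
  - by move=> y; rewrite mule_ge0// lee_fin.
  apply: eq_integral => y _.
  by rewrite addrK addrC.
rewrite (fubini_tonelli (fun xy : 'cV[TR]_n * 'cV[TR]_n =>
    F xy.2 * (g ((xy.2 : 'cV[R]_n) - A *m (xy.1 : 'cV[R]_n))%R)%:E)) //=;
      last 2 first.
- apply: emeasurable_funM; first exact: (measurableT_comp mF measurable_snd).
  exact: (measurableT_comp mEg msub).
- by move=> x; rewrite mule_ge0 // lee_fin.
have gE (y : 'cV[R]_n) : \int[power_measure mu n]_x
  (g (y - A *m (x : 'cV[R]_n))%R)%:E = c.
  have mgy : measurable_fun [set: 'cV[TR]_n]
      (fun x : 'cV[TR]_n => (g (y - A *m (x : 'cV[R]_n))%R)%:E).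
    apply: (measurableT_comp mEg); apply: measurable_to_cV => i.
    under eq_fun do rewrite mxE.
    apply: measurable_funD => //; under eq_fun do rewrite mxE.
    by apply: measurable_funN;
      exact: (measurableT_comp (measurable_coord i) mA).
  rewrite -(ge0_integral_power_lebesgueD (invmx A *m y)%R mgy).
    by apply: eq_integral => x _;
      rewrite mulmxDr mulKVmx// opprD addrCA subrr addr0.
  by move=> x; rewrite lee_fin.
rewrite -ge0_integralZl//; last by apply: integral_ge0 => v _; rewrite lee_fin.
apply: eq_integral => y _; rewrite ge0_integralZl//; last 2 first.
- apply: (measurableT_comp mEg); apply: measurable_to_cV => i.
  under eq_fun do rewrite mxE.
  apply: measurable_funD => //; under eq_fun do rewrite mxE.
  by apply: measurable_funN; exact: (measurableT_comp (measurable_coord i) mA).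
- by move=> x _; rewrite lee_fin.
by rewrite (gE y) muleC.
Qed.

End linear_change.

(** * Density of a linear image of a standard Gaussian vector *)

Section gram_matrix.
Context (R : realFieldType).

Lemma trmx_mul_self_eq0 n (u : 'cV[R]_n) : (u^T *m u) ord0 ord0 = 0 -> u = 0.
Proof.
rewrite mxE; under eq_bigr do rewrite mxE -expr2.
move/eqP; rewrite psumr_eq0 => [/allP u0|i _]; last exact: sqr_ge0.
apply/colP => i; rewrite mxE; apply/eqP.
by have := u0 i (mem_index_enum _); rewrite sqrf_eq0.
Qed.

(** If [v *m (B *m B^T) = 0], then [v *m B] has squared norm zero. *)
Lemma row_free_gram m n (B : 'M[R]_(m, n)) : row_free B -> B *m B^T \in unitmx.
Proof.
move=> fB; rewrite -row_free_unit; apply/inj_row_free => v vBB.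
have : (v *m B)^T = 0.
  apply: trmx_mul_self_eq0.
  by rewrite trmxK trmx_mul mulmxA -(mulmxA v) vBB mul0mx mxE.
by move/(congr1 trmx); rewrite trmxK trmx0 => /eqP;
  rewrite mulmx_free_eq0// => /eqP.
Qed.

Lemma gram_row_free m n (A : 'M[R]_(m, n)) : A *m A^T \in unitmx -> row_free A.
Proof.
move=> Au; apply/inj_row_free => v vA0.
by rewrite -[v](mulmxK Au) mulmxA vA0 !mul0mx.
Qed.

(** [B] is a basis of the kernel of [A^T], which has dimension [q] by rank-nullity. *)
Lemma orthogonal_completion p q (A : 'M[R]_(p, p + q)) : A *m A^T \in unitmx ->
  exists2 B : 'M[R]_(q, p + q), A *m B^T = 0 & B *m B^T \in unitmx.
Proof.
move=> Au; have rA : \rank A = p by apply/eqP/gram_row_free.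
have rK : \rank (kermx A^T) = q by rewrite mxrank_ker mxrank_tr rA addKn.
have : (row_base (kermx A^T) <= kermx A^T)%MS by rewrite eq_row_base.
have := row_base_free (kermx A^T).
(* The number of rows of [row_base] is a rank, so the matrix is generalized before that rank is
   rewritten to [q]. *)
move: (row_base _); rewrite rK => B fB /sub_kermxP BA.
exists B; last exact: row_free_gram.
by apply: trmx_inj; rewrite trmx_mul trmxK trmx0.
Qed.

(** [col_mx A B] has an explicit right inverse; multiplied in the other order, the two resolve the
    identity into the orthogonal projections onto the row spaces of [A] and [B]. *)
Lemma orthogonal_decomposition p q (A : 'M[R]_(p, p + q))
    (B : 'M[R]_(q, p + q)) :
  A *m A^T \in unitmx -> A *m B^T = 0 -> B *m B^T \in unitmx ->
  col_mx A B \in unitmx /\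
  forall u : 'cV[R]_(p + q), u^T *m u =
    (A *m u)^T *m invmx (A *m A^T) *m (A *m u) +
    (B *m u)^T *m invmx (B *m B^T) *m (B *m u).
Proof.
move=> Au AB Bu; have BA : B *m A^T = 0.
  by apply: trmx_inj; rewrite trmx_mul trmxK trmx0.
have ABE : col_mx A B *m row_mx (A^T *m invmx (A *m A^T))
  (B^T *m invmx (B *m B^T)) = 1%:M.
  rewrite mul_col_row !mulmxA AB BA !mul0mx !mulmxV//.
  by rewrite -scalar_mx_block.
have [ABu _] := mulmx1_unit ABE.
split=> // u; rewrite !trmx_mul -!mulmxA -mulmxDr; congr (_ *m _).
have := mulmx1C ABE; rewrite mul_row_col => E.
by rewrite -{1}[u]mul1mx -E mulmxDl -!mulmxA.
Qed.

End gram_matrix.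

Section gaussian_density.
Local Open Scope ereal_scope.
Context (R : realType).
Notation TR := (measurableTypeR R).
Notation mu := (@lebesgue_measure R).
Notation gamma := (@normal_prob R 0 1).

(** The centered Gaussian density of covariance [Sigma] without its normalization; it has this
    meaning only for invertible [Sigma], as [invmx] returns a singular matrix unchanged. *)
Definition gauss_weight n (Sigma : 'M[R]_n) (y : 'cV[R]_n) : R :=
  expR (- (2^-1 * (y^T *m invmx Sigma *m y) ord0 ord0)).

Lemma measurable_gauss_weight n (Sigma : 'M[R]_n) :
  measurable_fun [set: 'cV[TR]_n] (gauss_weight Sigma : 'cV[TR]_n -> R).
Proof.
apply: measurableT_comp => //; apply: measurable_funN.
by apply: measurable_funM => //; exact: measurable_quad_form.
Qed.

Lemma normal_pdf01 (x : R) :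
  normal_pdf 0 1 x = (normal_peak 1 * expR (- (2^-1 * x ^+ 2)))%R.
Proof.
rewrite normal_pdfE ?oner_neq0// /normal_fun subr0 expr1n; congr (_ * expR _)%R.
by rewrite mulNr mulrC.
Qed.

Lemma prod_normal_pdf n (u : 'cV[R]_n) :
  (\prod_i normal_pdf 0 1 (u i ord0) =
   normal_peak 1 ^+ n * expR (- (2^-1 * (u^T *m u) ord0 ord0)))%R.
Proof.
under eq_bigr do rewrite normal_pdf01.
rewrite big_split /= prodr_const card_ord -expR_sum; congr (_ * expR _)%R.
rewrite mxE mulr_sumr -sumrN; apply: eq_bigr => i _.
by rewrite mxE expr2.
Qed.

(* [A] is completed by an orthogonal complement [B] of its rows to an invertible
   matrix, in whose coordinates the standard Gaussian weight splits into a
   factor depending on [A u] and one depending on [B u], which is integrated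
   out. *)
Lemma gaussian_image_density p k (A : 'M[R]_(p, k)) : A *m A^T \in unitmx ->
  exists2 c : \bar R, 0 <= c & forall F : 'cV[TR]_p -> \bar R,
    measurable_fun setT F -> (forall y, 0 <= F y) ->
    \int[power_measure gamma k]_u F (A *m (u : 'cV[R]_k))%R =
    c * \int[power_measure mu p]_y (F y * (gauss_weight (A *m A^T) y)%:E).
Proof.
move=> Au.
have pk : (p <= k)%N.
  by have /eqP <- := gram_row_free Au; exact: rank_leq_col.
have [q kE] : exists q, k = (p + q)%N by exists (k - p)%N; rewrite subnKC.
subst k; have [B AB Bu] := orthogonal_completion Au.
have [ABu quadE] := orthogonal_decomposition Au AB Bu.
have [c c0 cE] := ge0_integral_mulmx ABu.
set w1 := gauss_weight (A *m A^T); set w2 := gauss_weight (B *m B^T).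
have mw1 : measurable_fun [set: 'cV[TR]_p] (EFin \o w1 : 'cV[TR]_p -> \bar R).
  by apply/measurable_EFinP; exact: measurable_gauss_weight.
have mw2 : measurable_fun [set: 'cV[TR]_q] (EFin \o w2 : 'cV[TR]_q -> \bar R).
  by apply/measurable_EFinP; exact: measurable_gauss_weight.
have w10 y : (0 <= w1 y)%R by exact: expR_ge0.
have w20 y : (0 <= w2 y)%R by exact: expR_ge0.
pose K : R := (normal_peak 1 ^+ (p + q))%R.
have K0 : (0 <= K)%R by rewrite exprn_ge0// normal_peak_ge0.
pose I2 := \int[power_measure mu q]_z (w2 z)%:E.
have I20 : 0 <= I2 by apply: integral_ge0 => z _; rewrite lee_fin.
(* [c] comes from the linear change of variables, [K] from the peaks of the normal densities, and
   [I2] is the mass of the integrated-out factor. At this stage [c] and [I2] may be infinite. *)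
exists (c * (K%:E * I2)) => [|F mF F0]; first by rewrite !mule_ge0.
have mup : measurable_fun [set: 'cV[TR]_(p + q)] (usubmx : _ -> 'cV[TR]_p).
  apply: measurable_to_cV => i; under eq_fun do rewrite mxE.
  exact: measurable_coord.
have mdn : measurable_fun [set: 'cV[TR]_(p + q)] (dsubmx : _ -> 'cV[TR]_q).
  apply: measurable_to_cV => i; under eq_fun do rewrite mxE.
  exact: measurable_coord.
(* The integrand in the coordinates [(A u, B u)]. *)
pose G (x : 'cV[TR]_(p + q)) : \bar R :=
  F (usubmx x) * (w1 (usubmx x))%:E * (K%:E * (w2 (dsubmx x))%:E).
have G0 x : 0 <= G x by rewrite !mule_ge0// lee_fin.
have mG : measurable_fun setT G.
  apply: emeasurable_funM.
    apply: emeasurable_funM; first exact: (measurableT_comp mF mup).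
    exact: (measurableT_comp mw1 mup).
  apply: measurable_funeM.
  exact: (measurableT_comp mw2 mdn).
transitivity (\int[power_measure mu (p + q)]_x G
  (col_mx A B *m (x : 'cV[R]_(p + q)))%R).
  rewrite (ge0_integral_power_density (mu := mu) (measurable_normal_pdf 0 1)
    (normal_pdf_ge0 0 1) (@ge0_integral_normal_prob R)); last 2 first.
  - exact: (measurableT_comp mF (measurable_mulmx_cV A)).
  - by move=> u; exact: F0.
  apply: eq_integral => u _.
  rewrite /G mul_col_mx col_mxKu col_mxKd -muleA; congr (_ * _).
  rewrite prod_normal_pdf quadE mxE mulrDr opprD expRD -/K.
  by rewrite -!EFinM mulrCA.
rewrite cE // -muleA; congr (_ * _).
rewrite ge0_integral_power_measureD //.
have mFw : measurable_fun setT (fun y : 'cV[TR]_p => F y * (w1 y)%:E).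
  exact: emeasurable_funM.
rewrite -ge0_integralZl//; last 2 first.
- by move=> y _; rewrite mule_ge0 ?lee_fin.
- by rewrite mule_ge0 ?lee_fin.
apply: eq_integral => y _; rewrite muleC /I2.
rewrite -[in RHS]ge0_integralZl//; last by move=> z _; rewrite lee_fin.
have mKw : measurable_fun setT (fun z : 'cV[TR]_q => K%:E * (w2 z)%:E).
  exact: measurable_funeM.
transitivity (\int[power_measure mu q]_z
  (F y * (w1 y)%:E * (K%:E * (w2 z)%:E))).
  by apply: eq_integral => z _; rewrite /G col_mxKu col_mxKd.
rewrite (ge0_integralZl _ _ mKw) //.
- by move=> z _; rewrite mule_ge0 ?lee_fin.
- by rewrite mule_ge0 ?lee_fin.
Qed.

(** Taking [F = 1] gives [c * W = 1] in the extended reals. Since [0 * +oo = 0], this excludes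
    infinite factors and yields [c = W^-1]. *)
Lemma gaussian_image_density_normalized p k (A : 'M[R]_(p, k)) :
  A *m A^T \in unitmx ->
  let W := \int[power_measure mu p]_y (gauss_weight (A *m A^T) y)%:E in
  (0 < fine W)%R /\
  forall F : 'cV[TR]_p -> \bar R,
    measurable_fun setT F -> (forall y, 0 <= F y) ->
    \int[power_measure gamma k]_u F (A *m (u : 'cV[R]_k))%R =
    \int[power_measure mu p]_y
      (F y * ((fine W)^-1 * gauss_weight (A *m A^T) y)%:E).
Proof.
move=> Au W; have [c c0 cE] := gaussian_image_density Au.
have W0 : 0 <= W by apply: integral_ge0 => y _; rewrite lee_fin expR_ge0.
have cW : c * W = 1.
  have := cE (fun=> 1) (measurable_cst _) (fun=> lee01).
  rewrite (integral_power_normal_prob1 R k) => ->; congr (_ * _).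
  by apply: eq_integral => y _; rewrite mul1e.
case: c c0 cE cW => [c||] // c0 cE cW; last first.
  move: cW; have [->|Wn0] := eqVneq W 0; first by rewrite mule0 => /eqP;
    rewrite eq_sym onee_eq0.
  by rewrite gt0_mulye// lt0e Wn0.
case: W W0 cW => [W||] // W0 cW; last first.
  move: c0 cW; rewrite lee_fin le_eqVlt => /orP[/eqP <-|c0].
    by rewrite mul0e => /eqP; rewrite eq_sym onee_eq0.
  by rewrite gt0_muley// lte_fin.
have {}cW : (c * W = 1)%R by apply: EFin_inj; rewrite EFinM.
have Wn0 : W != 0%R by apply/eqP => W00; move/eqP: cW;
  rewrite W00 mulr0 eq_sym oner_eq0.
split=> [|F mF F0 /=]; first by rewrite /= lt_neqAle eq_sym Wn0 -lee_fin.
have -> : (W^-1 = c)%R by apply: (mulIf Wn0); rewrite mulVf.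
rewrite cE // -ge0_integralZl//; last 2 first.
- apply: emeasurable_funM => //; apply/measurable_EFinP.
  exact: measurable_gauss_weight.
- by move=> y _; rewrite mule_ge0// lee_fin expR_ge0.
by apply: eq_integral => y _; rewrite EFinM muleCA.
Qed.

End gaussian_density.

(** * Second moments *)

Section normal_moments.
Local Open Scope ereal_scope.
Context (R : realType).
Notation TR := (measurableTypeR R).
Notation mu := (@lebesgue_measure R).
Notation gamma := (@normal_prob R 0 1).
Notation phi := (@normal_pdf R 0 1).
Import numFieldNormedType.Exports.

Lemma is_derive_normal_pdf01 (x : R) :
  is_derive x 1%R (fun y => - phi y)%R (x * phi x)%R.
Proof.
have -> : (fun y : R => - phi y)%R =
    (fun y => - (normal_peak 1 * expR (- (2^-1 * y ^+ 2))))%R.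
  by apply/funext => y; rewrite normal_pdf01.
rewrite normal_pdf01.
apply: is_derive_eq => /=.
by rewrite /GRing.scale /=; field.
Qed.

Lemma cvg_normal_pdf01 : phi x @[x --> +oo%R] --> (0%R : R).
Proof.
have -> : phi = (fun x => normal_peak 1 * expR (- (2^-1 * x ^+ 2)))%R.
  by apply/funext => y; rewrite normal_pdf01.
rewrite -[X in _ --> X](mulr0 (normal_peak 1)); apply: cvgMr.
apply: (cvg_comp (fun x => 2^-1 * x ^+ 2)%R (fun x => expR (- x))%R);
  last exact: cvgr_expR.
apply/gt0_cvgMry; last exact: cvgr_expr2.
by rewrite invr_gt0.
Qed.

(** [- phi] is a primitive of [x * phi x] that tends to zero at infinity. *)
Lemma integral_id_normal_pdf01 (y : R) : (0 <= y)%R ->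
  \int[mu]_(x in `[y, +oo[) (x * phi x)%:E = (phi y)%:E.
Proof.
move=> y0; have dphi := is_derive_normal_pdf01.
rewrite (@ge0_continuous_FTC2y R _ (fun x => - phi x)%R y 0%R).
- by rewrite sub0e -EFinN opprK.
- by move=> x yx; rewrite mulr_ge0 ?normal_pdf_ge0 ?(le_trans y0).
- apply: continuous_subspaceT => x; apply: cvgM; first exact: cvg_id.
  by apply: continuous_normal_pdf; exact: oner_neq0.
- by rewrite -[X in _ --> X]oppr0; apply: cvgN; exact: cvg_normal_pdf01.
- by move=> x _; have [] := dphi x.
- apply: cvgN; apply: cvg_at_right_filter.
  by apply: continuous_normal_pdf; exact: oner_neq0.
- by move=> x _; rewrite derive1E; have [_ ->] := dphi x.
Qed.

Lemma integral_sqr_normal_pdf01 : \int[mu]_x (x ^+ 2 * phi x)%:E = 1.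
Proof.
have phiN x : phi (- x)%R = phi x by rewrite !normal_pdf01 sqrrN.
have mphi := @measurable_normal_pdf R 0 1.
have phi0 x : (0 <= phi x)%R by exact: normal_pdf_ge0.
rewrite ge0_symfun_integralT //=; last 3 first.
- by move=> x; rewrite mulr_ge0// sqr_ge0.
- move=> x; apply: cvgM; first exact: exprn_continuous.
  by apply: continuous_normal_pdf; exact: oner_neq0.
- by move=> x /=; rewrite sqrrN phiN.
(* The value [1] is replaced by the total mass of [phi], so that two integrals over the half-line
   are compared and neither is evaluated. *)
rewrite -(integral_normal_pdf 0 1) [RHS]ge0_symfun_integralT //=; last 2 first.
- by apply: continuous_normal_pdf; exact: oner_neq0.
- by move=> x /=; rewrite phiN.
congr (_ * _); rewrite -set_itvcy.
(* Write one factor [x] of [x * (x * phi x)] as the length of [0, x] and exchange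
   the integrals: the inner one is [phi y], since [phi' x = - x * phi x]. *)
pose D : set (TR * TR) := [set xy | (0 <= xy.2 <= xy.1)%R].
pose k (xy : TR * TR) : \bar R := (\1_D xy * (xy.1 * phi xy.1))%:E.
have DE xy : (xy \in D) = (0 <= xy.2 <= xy.1)%R by apply/idP/idP; rewrite inE.
have mD : measurable D.
  rewrite (_ : D = snd @^-1` `[0%R, +oo[ `&`
      (fun xy : TR * TR => xy.1 - xy.2)%R @^-1` `[0%R, +oo[).
    apply: measurableI; rewrite -[X in measurable X]setTI.
      exact: measurable_snd.
    apply: (measurable_funB (f := fst : TR * TR -> R) (g := snd)) => //.
  apply/seteqP; split => -[x y] /=; rewrite !in_itv /= !andbT subr_ge0.
    by move/andP.
  by move=> [? ?]; apply/andP.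
have k0 xy : 0 <= k xy.
  rewrite lee_fin indicE DE;
    case: (boolP (_ <= _ <= _)%R) => [/andP[y0 yx]|_]; last by rewrite mul0r.
  by rewrite mul1r mulr_ge0// (le_trans y0).
have mk : measurable_fun setT k.
  apply/measurable_EFinP; apply: measurable_funM; first exact: measurable_indic.
  apply: measurable_funM; first exact: measurable_fst.
  exact: (measurableT_comp mphi measurable_fst).
transitivity (\int[mu]_x \int[mu]_y k (x, y)).
  rewrite integral_mkcond; apply: eq_integral => x _.
  rewrite patchE mem_setE in_itv /= andbT; case: ifPn => x0.
    transitivity (\int[mu]_(y in `[0%R, x]) (x * phi x)%:E).
      have muE : mu `[0%R, x] = x%:E.
        rewrite lebesgue_measure_itv /= lte_fin; case: ifPn;
          first by rewrite -EFinB subr0.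
        by rewrite -leNgt => x1; congr EFin; apply/le_anti/andP.
      rewrite (integral_cst mu (measurable_itv `[0%R, x]) (x * phi x)%:E).
      transitivity ((x * phi x)%:E * mu `[0%R, x]); last by [].
      by rewrite muE -EFinM; congr EFin; ring.
    rewrite integral_mkcond; apply: eq_integral => y _;
      rewrite patchE /k indicE.
    by rewrite DE mem_setE /= in_itv /=; case: (boolP (_ <= _ <= _)%R) => _;
      rewrite ?mul1r ?mul0r.
  rewrite integral0_eq // => y _; rewrite /k indicE DE;
    case: (boolP (_ <= _ <= _)%R) => [/andP[y0 yx]|_]; rewrite ?mul0r//.
  by case/negP: x0; exact: le_trans yx.
rewrite (fubini_tonelli k) //; apply/esym.
rewrite integral_mkcond; apply: eq_integral => y _.
rewrite patchE mem_setE in_itv /= andbT; case: ifPn => y0.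
  rewrite -integral_id_normal_pdf01// integral_mkcond.
  apply: eq_integral => x _;
    rewrite patchE /k indicE DE y0 mem_setE /= in_itv /= andbT.
  by case: (boolP (y <= x)%R) => _; rewrite ?mul1r ?mul0r.
rewrite integral0_eq // => x _; rewrite /k indicE DE;
  case: (boolP (_ <= _ <= _)%R) => [/andP[y1 _]|_].
  by case/negP: y0.
by rewrite mul0r.
Qed.

End normal_moments.

Section power_normal_moments.
Local Open Scope ereal_scope.
Context (R : realType).
Notation TR := (measurableTypeR R).
Notation mu := (@lebesgue_measure R).
Notation gamma := (@normal_prob R 0 1).

Lemma ge0_integral_normalN (F : TR -> \bar R) :
  measurable_fun setT F -> (forall x, 0 <= F x) ->
  \int[gamma]_x F (- x)%R = \int[gamma]_x F x.
Proof.
move=> mF F0.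
have mN : measurable_fun [set: TR] (-%R : TR -> TR) by exact: oppr_measurable.
have mFN : measurable_fun [set: TR] (fun x : TR => F (- x)%R)
  by exact: (measurableT_comp mF mN).
rewrite !ge0_integral_normal_prob//.
have mphi := @measurable_normal_pdf R 0 1.
pose G (x : TR) := F x * (normal_pdf 0 1 x)%:E.
have mG : measurable_fun setT G.
  by apply: emeasurable_funM => //; exact/measurable_EFinP.
have G0 x : 0 <= G x by rewrite mule_ge0// lee_fin normal_pdf_ge0.
transitivity (\int[pushforward mu (-%R : TR -> TR)]_x G x).
  rewrite (ge0_integral_pushforward mN mu measurableT mG (fun x _ => G0 x)).
  rewrite preimage_setT; apply: eq_integral => x _ /=.
  by rewrite /G !normal_pdf01 sqrrN.
apply: eq_measure_integral => A mA _; exact: lebesgue_measureN.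
Qed.

Lemma integral_sqr_normal_prob : \int[gamma]_x (x ^+ 2)%:E = 1.
Proof.
rewrite -(@integral_sqr_normal_pdf01 R)
  (ge0_integral_normal_prob (F := fun x : TR => (x ^+ 2)%:E)) //.
- by apply/measurable_EFinP; exact: measurable_funX.
- by move=> x; rewrite lee_fin sqr_ge0.
Qed.

Lemma integral_sqr_affine_normal_prob (a b : R) :
  \int[gamma]_x ((a * x + b) ^+ 2)%:E = (a ^+ 2 + b ^+ 2)%:E.
Proof.
have mab c : measurable_fun [set: TR]
  (fun x : TR => ((c * (x : R) + b) ^+ 2)%:E).
  apply/measurable_EFinP; apply: measurable_funX.
  by apply: measurable_funD => //; exact: measurable_funM.
set L := LHS.
(* Averaging over [x] and [-x] removes the cross term, so that only nonnegative
   integrands occur. *)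
have : L + L = (2 * (a ^+ 2 + b ^+ 2))%:E.
  rewrite -{2}[L](ge0_integral_normalN
    (F := fun x : TR => ((a * (x : R) + b) ^+ 2)%:E)) //; last first.
    by move=> x; rewrite lee_fin sqr_ge0.
  rewrite -ge0_integralD //; first last.
  - under eq_fun do rewrite mulrN -mulNr.
    exact: mab.
  - by move=> x _; rewrite lee_fin sqr_ge0.
  - by move=> x _; rewrite lee_fin sqr_ge0.
  transitivity (\int[gamma]_x
    ((2 * a ^+ 2)%:E * ((x : R) ^+ 2)%:E + (2 * b ^+ 2)%:E)).
    by apply: eq_integral => x _; rewrite -EFinD -EFinM -EFinD; congr EFin;
      ring.
  rewrite ge0_integralD //; first last.
  - by move=> x _; rewrite lee_fin mulr_ge0// sqr_ge0.
  - by apply: measurable_funeM; apply/measurable_EFinP; exact: measurable_funX.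
  - by move=> x _; rewrite -EFinM lee_fin mulr_ge0 ?sqr_ge0// mulr_ge0 ?sqr_ge0.
  rewrite ge0_integralZl //; first last.
  - by rewrite lee_fin mulr_ge0 ?sqr_ge0.
  - by move=> x _; rewrite lee_fin sqr_ge0.
  - by apply/measurable_EFinP; exact: measurable_funX.
  rewrite integral_sqr_normal_prob mule1
    (integral_cst gamma measurableT (2 * b ^+ 2)%:E).
  transitivity ((2 * a ^+ 2)%:E + (2 * b ^+ 2)%:E * gamma setT); first by [].
  by rewrite probability_setT mule1 -EFinD mulrDr.
(* Infinite values are incompatible with the doubled equation, so the halving takes place among
   finite numbers. *)
case: L => [l||] //= [ll]; congr EFin.
by lra.
Qed.

(** The offset [b] carries the induction: once the first coordinate is fixed at [x], the offset
    becomes [a0 * x + b], and the one-dimensional case integrates its square over [x]. *)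
Lemma integral_sqr_affine_power_normal n (a : 'rV[R]_n) (b : R) :
  \int[power_measure gamma n]_u (((a *m (u : 'cV[R]_n)) ord0 ord0 + b) ^+ 2)%:E =
  ((a *m a^T) ord0 ord0 + b ^+ 2)%:E.
Proof.
have maff k (a' : 'rV[R]_k) b' : measurable_fun [set: 'cV[TR]_k]
    (fun u : 'cV[TR]_k => (((a' *m (u : 'cV[R]_k)) ord0 ord0 + b') ^+ 2)%:E).
  apply/measurable_EFinP; apply: measurable_funX; apply: measurable_funD => //.
  exact: (measurableT_comp (measurable_coord _) (measurable_mulmx_cV a')).
elim: n a b => [|n IH] a b.
  rewrite ge0_integral_power_measure0 //; last by move=> v;
    rewrite lee_fin sqr_ge0.
  by rewrite !mxE !big_ord0 !add0r.
rewrite ge0_integral_power_measureS //; last by move=> v;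
  rewrite lee_fin sqr_ge0.
pose a0 := a ord0 ord0; pose a1 : 'rV[R]_n := \row_j a ord0 (lift ord0 j).
have aE x (v : 'cV[R]_n) : (a *m vcons (x, v)) ord0 ord0 =
  ((a1 *m v) ord0 ord0 + a0 * x)%R.
  rewrite !mxE big_ord_recl vcons0 addrC; congr (_ + _)%R.
  by apply: eq_bigr => j _; rewrite vcons_lift mxE.
under eq_integral => x _ do under eq_integral => v _ do rewrite aE -addrA.
under eq_integral => x _ do rewrite IH EFinD.
rewrite ge0_integralD //; first last.
- apply/measurable_EFinP; apply: measurable_funX.
  by apply: measurable_funD => //; exact: measurable_funM.
- by move=> x _; rewrite lee_fin sqr_ge0.
- by move=> x _; rewrite lee_fin mxE sumr_ge0// => j _;
    rewrite [a1^T _ _]mxE -expr2 sqr_ge0.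
rewrite integral_sqr_affine_normal_prob
  (integral_cst gamma measurableT ((a1 *m a1^T) ord0 ord0)%:E).
transitivity (((a1 *m a1^T) ord0 ord0)%:E * gamma setT + (a0 ^+ 2 + b ^+ 2)%:E);
  first by [].
rewrite probability_setT mule1 -EFinD addrA; congr (_ + _)%:E.
rewrite !mxE big_ord_recl addrC !mxE expr2; congr (_ + _)%R.
by apply: eq_bigr => j _; rewrite !mxE.
Qed.

End power_normal_moments.

(** * Moments of a vector whose law is Gaussian *)

Section gaussian_vector.
Context d (Omega : measurableType d) (R : realType) (P : probability Omega R).
Notation TR := (measurableTypeR R).
Notation gamma := (@normal_prob R 0 1).
Variables (p k : nat) (X : Omega -> 'cV[R]_p) (A : 'M[R]_(p, k)) (b : 'cV[R]_p).
Hypothesis mX : measurable_fun setT (X : Omega -> 'cV[TR]_p).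
Hypothesis lawX : forall B : set 'cV[TR]_p, measurable B ->
  P [set w | B (X w)] = power_measure gamma k
    [set u : 'cV[TR]_k | B (A *m (u : 'cV[R]_k) + b)].

Lemma ge0_integral_gaussian_vector (F : 'cV[TR]_p -> \bar R) :
  measurable_fun setT F -> (forall y, 0 <= F y)%E ->
  (\int[P]_w F (X w) = \int[power_measure gamma k]_u F
    (A *m (u : 'cV[R]_k) + b)%R)%E.
Proof.
move=> mF F0.
have mA : measurable_fun [set: 'cV[TR]_k]
  (fun u : 'cV[TR]_k => (A *m (u : 'cV[R]_k) + b : 'cV[TR]_p)).
  exact: (measurableT_comp (measurable_cV_addr b) (measurable_mulmx_cV A)).
transitivity (\int[pushforward P (X : Omega -> 'cV[TR]_p)]_y F y)%E.
  by rewrite (ge0_integral_pushforward mX P measurableT mF (fun y _ => F0 y))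
    preimage_setT.
transitivity (\int[pushforward (power_measure gamma k)
    (fun u : 'cV[TR]_k => (A *m (u : 'cV[R]_k) + b : 'cV[TR]_p)%R)]_y F y)%E.
  by apply: eq_measure_integral => B mB _; exact: lawX.
by rewrite (ge0_integral_pushforward mA (power_measure gamma k) measurableT mF
  (fun y _ => F0 y))
  preimage_setT.
Qed.

(** Affine forms include the constant [1], so the mean of a coordinate is also a mixed moment of two
    such forms. *)
Let aff (xi : 'rV[R]_p) (c : R) (w : Omega) : R := (xi *m X w) ord0 ord0 + c.

Lemma measurable_affine_form (xi : 'rV[R]_p) (c : R) :
  measurable_fun setT (aff xi c).
Proof.
apply: measurable_funD => //.
exact: (measurableT_comp (measurable_coord _)
  (measurableT_comp (measurable_mulmx_cV xi) mX)).
Qed.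

Lemma integral_sqr_gaussian_vector (xi : 'rV[R]_p) (c : R) :
  (\int[P]_w ((aff xi c w) ^+ 2)%:E =
   ((xi *m A *m (xi *m A)^T) ord0 ord0 + ((xi *m b) ord0 ord0 + c) ^+ 2)%:E)%E.
Proof.
rewrite -integral_sqr_affine_power_normal.
rewrite (ge0_integral_gaussian_vector
  (F := fun y : 'cV[TR]_p => (((xi *m (y : 'cV[R]_p)) ord0 ord0 + c) ^+ 2)%:E)).
- by apply: eq_integral => u _; rewrite mulmxDr mxE -addrA mulmxA.
- apply/measurable_EFinP; apply: measurable_funX; apply: measurable_funD => //.
  exact: (measurableT_comp (measurable_coord _) (measurable_mulmx_cV xi)).
- by move=> y; rewrite lee_fin sqr_ge0.
Qed.

Lemma integrable_sqr_gaussian_vector (xi : 'rV[R]_p) (c : R) :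
  P.-integrable setT (EFin \o (fun w => (aff xi c w) ^+ 2)).
Proof.
apply/integrableP; split.
  by apply/measurable_EFinP; apply: measurable_funX;
    exact: measurable_affine_form.
under eq_integral do rewrite /= ger0_norm ?sqr_ge0//.
by rewrite integral_sqr_gaussian_vector ltry.
Qed.

(** Squares can be integrated through the law of [X] without knowing integrability; products inherit
    integrability and their integrals from them. *)
Let affM_polarization xi eta c e w : aff xi c w * aff eta e w =
  4^-1 * ((aff (xi + eta) (c + e) w) ^+ 2 - (aff (xi - eta) (c - e) w) ^+ 2).
Proof. by rewrite /aff mulmxDl mulmxBl !mxE; field. Qed.

Lemma integrable_mul_gaussian_vector xi eta c e :
  P.-integrable setT (EFin \o (fun w => aff xi c w * aff eta e w)).
Proof.
have -> : EFin \o (fun w => aff xi c w * aff eta e w) = (fun w => 4^-1%:E *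
    (((aff (xi + eta) (c + e) w) ^+ 2)%:E -
      ((aff (xi - eta) (c - e) w) ^+ 2)%:E))%E.
  by apply/funext => w /=; rewrite affM_polarization EFinM EFinB.
apply: integrableZl => //; apply: integrableB => //;
exact: integrable_sqr_gaussian_vector.
Qed.

Lemma Rintegral_mul_gaussian_vector xi eta c e :
  \int[P]_w (aff xi c w * aff eta e w) =
  (xi *m A *m (eta *m A)^T) ord0 ord0 +
  ((xi *m b) ord0 ord0 + c) * ((eta *m b) ord0 ord0 + e).
Proof.
under eq_Rintegral do rewrite affM_polarization.
have h1 := integrable_sqr_gaussian_vector (xi + eta) (c + e).
have h2 := integrable_sqr_gaussian_vector (xi - eta) (c - e).
rewrite RintegralZl//; last exact: (integrableB _ h1 h2).
rewrite RintegralB// /Rintegral !integral_sqr_gaussian_vector /=.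
have symA (U V : 'rV[R]_k) : (V *m U^T) ord0 ord0 = (U *m V^T) ord0 ord0.
  have <- : (U *m V^T)^T = V *m U^T by rewrite trmx_mul trmxK.
  by rewrite mxE.
have addE (U V : 'M[R]_1) : (U + V) ord0 ord0 = U ord0 ord0 + V ord0 ord0.
  by rewrite mxE.
have oppE (U : 'M[R]_1) : (- U) ord0 ord0 = - U ord0 ord0 by rewrite mxE.
have trD (U V : 'rV[R]_k) : (U + V)^T = U^T + V^T by apply/matrixP => i j;
  rewrite !mxE.
have trN (U : 'rV[R]_k) : (- U)^T = - U^T by apply/matrixP => i j; rewrite !mxE.
have sqD (U V : 'rV[R]_k) : ((U + V) *m (U + V)^T) ord0 ord0 =
    (U *m U^T) ord0 ord0 + 2 * (U *m V^T) ord0 ord0 + (V *m V^T) ord0 ord0.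
  by rewrite trD mulmxDl !mulmxDr !addE (symA U V); ring.
rewrite !(mulmxDl _ _ A) !(mulmxDl _ _ b) !mulNmx !sqD trN !mulNmx !mulmxN opprK
  !addE !oppE.
by field.
Qed.

Let coordE i w : X w i ord0 = aff (delta_mx ord0 i) 0 w.
Proof. by rewrite /aff -rowE mxE addr0. Qed.

Lemma integrable_mul_coord i j :
  P.-integrable setT (EFin \o (fun w => X w i ord0 * X w j ord0)).
Proof.
rewrite [X in EFin \o X](_ : _ = fun w => aff (delta_mx ord0 i) 0 w * aff
  (delta_mx ord0 j) 0 w).
  exact: integrable_mul_gaussian_vector.
by apply/funext => w; rewrite !coordE.
Qed.

Lemma Rintegral_mul_coord i j :
  \int[P]_w (X w i ord0 * X w j ord0) = (A *m A^T) i j + b i ord0 * b j ord0.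
Proof.
under eq_Rintegral do rewrite !coordE.
rewrite Rintegral_mul_gaussian_vector !addr0 -!rowE !mxE; congr (_ + _).
by apply: eq_bigr => l _; rewrite !mxE.
Qed.

Lemma Rintegral_coord i : \int[P]_w X w i ord0 = b i ord0.
Proof.
transitivity (\int[P]_w (aff (delta_mx ord0 i) 0 w * aff 0 1 w)).
  by apply: eq_Rintegral => w _;
    rewrite coordE /aff mul0mx [X in _ * (X + _)]mxE add0r mulr1.
rewrite Rintegral_mul_gaussian_vector !mul0mx trmx0 mulmx0 addr0 -rowE.
by rewrite !mxE !add0r mulr1.
Qed.

End gaussian_vector.

(** * Law of the noise *)

Section complex_parts.
Context (R : rcfType).
Implicit Types x y : R[i].
Notation Re := complex.Re.
Notation Im := complex.Im.

Lemma complex_ReM x y : Re (x * y) = Re x * Re y - Im x * Im y.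
Proof. by case: x y => [a b] [c e]. Qed.

Lemma complex_ImM x y : Im (x * y) = Re x * Im y + Im x * Re y.
Proof. by case: x y => [a b] [c e]. Qed.

Lemma complex_ReMconj x y : Re (x * y^*) = Re x * Re y + Im x * Im y.
Proof. by case: x y => [a b] [c e] /=; rewrite mulrN opprK. Qed.

Lemma complex_ImMconj x y : Im (x * y^*) = Im x * Re y - Re x * Im y.
Proof. by case: x y => [a b] [c e] /=; rewrite mulrN addrC. Qed.

End complex_parts.

Section noise_covariance.
Context d (Omega : measurableType d) (R : realType) (P : probability Omega R).
Notation TR := (measurableTypeR R).
Notation gamma := (@normal_prob R 0 1).
Variables (cz : int -> int -> R[i]) (Z : int -> Omega -> R[i]).
Hypothesis mZ : forall k, measurable_fun setT (Z k).
Hypothesis noiseZ : proper_gaussian_noise P cz Z.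

Lemma measurable_real_noise n (t : 'I_n -> int) :
  measurable_fun setT (fun w => real_cV (\col_i Z (t i) w) : 'cV[TR]_(n + n)).
Proof.
apply: measurable_to_cV => i; rewrite -(splitK i);
  case: (fintype.split i) => j /=.
  under eq_fun do rewrite col_mxEu !mxE.
  exact: (measurableT_comp (@measurable_Re R) (mZ _)).
under eq_fun do rewrite col_mxEd !mxE.
exact: (measurableT_comp (@measurable_Im R) (mZ _)).
Qed.

(** For each pair of times, properness and the autocorrelation give four linear equations for the
    four mixed moments of real and imaginary parts. Properness says [RR = II] and [RI = - IR]; the
    autocorrelation gives [RR + II = Re c] and [IR - RI = Im c], whence the halves. *)
Lemma noise_law n (t : 'I_n -> int) : exists (k : nat) (A : 'M[R]_(n + n, k)),
  (forall B : set 'cV[TR]_(n + n), measurable B ->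
    P [set w | B (real_cV (\col_i Z (t i) w))] =
    power_measure gamma k [set u : 'cV[TR]_k | B (A *m (u : 'cV[R]_k) + 0)]) /\
  forall i j, let c := cz (t j) (t i - t j) in
    [/\ (A *m A^T) (lshift n i) (lshift n j) = complex.Re c / 2,
        (A *m A^T) (rshift n i) (rshift n j) = complex.Re c / 2,
        (A *m A^T) (rshift n i) (lshift n j) = complex.Im c / 2 &
        (A *m A^T) (lshift n i) (rshift n j) = - (complex.Im c / 2)].
Proof.
have [k [A [b law]]] := noise_gaussian noiseZ t.
pose X w := real_cV (\col_i Z (t i) w).
have mX : measurable_fun setT (X : Omega -> 'cV[TR]_(n + n))
  by exact: measurable_real_noise.
have XRe i w : complex.Re (Z (t i) w) = X w (lshift n i) ord0.
  by rewrite /X /real_cV col_mxEu !mxE.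
have XIm i w : complex.Im (Z (t i) w) = X w (rshift n i) ord0.
  by rewrite /X /real_cV col_mxEd !mxE.
have meanX := Rintegral_coord mX law.
(* The translation is the mean; once it vanishes, the second moments are the entries of
   [A *m A^T]. *)
have b0 : b = 0.
  apply/colP => i; rewrite [RHS]mxE -meanX.
  rewrite -(splitK i); case: (fintype.split i) => j /=.
    under eq_Rintegral do rewrite -XRe.
    by have [] := noise_mean noiseZ (t j).
  under eq_Rintegral do rewrite -XIm.
  by have [] := noise_mean noiseZ (t j).
subst b; exists k, A; split=> // i j c.
(* Integrability is what allows the expectation of a complex product to be split into real
   moments. *)
have intX i' j' := integrable_mul_coord mX law i' j'.
have covX i' j' : (A *m A^T) i' j' = \int[P]_w (X w i' ord0 * X w j' ord0).
  by rewrite (Rintegral_mul_coord mX law) !mxE mulr0 addr0.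
have tE : t j + (t i - t j) = t i by rewrite addrC subrK.
have := noise_proper noiseZ (t j) (t i - t j); rewrite tE => -[].
under eq_Rintegral do rewrite complex_ReM !XRe !XIm.
under [in X in _ -> X -> _]eq_Rintegral do rewrite complex_ImM !XRe !XIm.
rewrite RintegralB// RintegralD// -!covX => e1 e2.
have := noise_autocorrelation noiseZ (t j) (t i - t j); rewrite tE -/c.
case: c => cr ci [].
under eq_Rintegral do rewrite complex_ReMconj !XRe !XIm.
under [in X in _ -> X -> _]eq_Rintegral do rewrite complex_ImMconj !XRe !XIm.
rewrite RintegralB// RintegralD// -!covX /= => e3 e4.
split; lra.
Qed.

End noise_covariance.

(** * Complex covariances in real coordinates *)

Section real_covariance.
Context (R : realType) (n : nat).
Variables (S : 'M[R]_(n + n)) (C : 'M[R[i]]_n).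
Hypothesis SE : forall i j,
    [/\ S (lshift n i) (lshift n j) = complex.Re (C i j) / 2,
        S (rshift n i) (rshift n j) = complex.Re (C i j) / 2,
        S (rshift n i) (lshift n j) = complex.Im (C i j) / 2 &
        S (lshift n i) (rshift n j) = - (complex.Im (C i j) / 2)].

Lemma Re_sum I (r : seq I) (F : I -> R[i]) :
  complex.Re (\sum_(i <- r) F i) = \sum_(i <- r) complex.Re (F i).
Proof. exact: (big_morph (@complex.Re R) (@raddfD _ _ _)). Qed.

Lemma Im_sum I (r : seq I) (F : I -> R[i]) :
  complex.Im (\sum_(i <- r) F i) = \sum_(i <- r) complex.Im (F i).
Proof. exact: (big_morph (@complex.Im R) (@raddfD _ _ _)). Qed.

(** The block pattern [[Re, - Im; Im, Re]] is that of multiplication by [C] on real and imaginary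
    parts, so [S] is half of that operator. *)
Lemma real_covariance_mul (w : 'cV[R[i]]_n) :
  S *m real_cV w = 2^-1 *: real_cV (C *m w).
Proof.
apply/colP => i; rewrite mxE big_split_ord /= [RHS]mxE -(splitK i).
case: (fintype.split i) => l /=.
  rewrite col_mxEu !mxE Re_sum mulr_sumr -big_split /=; apply: eq_bigr => j _.
  have [-> _ _ ->] := SE l j.
  by rewrite col_mxEu col_mxEd !mxE complex_ReM; field.
rewrite col_mxEd !mxE Im_sum mulr_sumr -big_split /=; apply: eq_bigr => j _.
have [_ -> -> _] := SE l j.
by rewrite col_mxEu col_mxEd !mxE complex_ImM; field.
Qed.

(** Symmetry of [S] makes the real part of [C] symmetric; across the two off-diagonal blocks, of
    opposite signs, it makes the imaginary part antisymmetric. *)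
Lemma real_covariance_hermitian : S^T = S -> map_mx Num.conj C^T = C.
Proof.
move=> symS; apply/matrixP => i j; rewrite !mxE.
have [e1 _ e2 _] := SE i j; have [e3 _ _ e4] := SE j i.
have e5 : S (lshift n i) (lshift n j) = S (lshift n j) (lshift n i)
  by rewrite -{1}symS mxE.
have e6 : S (rshift n i) (lshift n j) = S (lshift n j) (rshift n i)
  by rewrite -{1}symS mxE.
move: e1 e2 e3 e4; rewrite e5 e6; case: (C i j) => a b;
  case: (C j i) => a' b' /= -> -> e3 e4.
have -> : a = a' by lra.
have -> : b = - b' by lra.
by [].
Qed.

End real_covariance.

Section hermitian_form.
Context (R : realType) (n : nat).

(** As a one-by-one matrix the form equals its own conjugate transpose. *)
Lemma hermitian_inverse_form_real (A : 'M[R[i]]_n) (v : 'cV[R[i]]_n) :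
  map_mx Num.conj A^T = A -> complex.Im (inverse_form A v) = 0.
Proof.
move=> hA; pose z := inverse_form A v.
have : Num.conj z = z.
  rewrite /z /inverse_form.
  set M := _ *m _ *m _.
  have {2}-> : M = map_mx Num.conj M^T.
    rewrite /M !trmx_mul !trmxK !map_mxM trmx_inv map_invmx map_trmx hA mulmxA;
      congr (_ *m _ *m _).
    by apply/matrixP => i j; rewrite !mxE; apply/esym; exact: conjCK.
  by rewrite !mxE.
rewrite -/z; case: z => a b [/eqP].
by rewrite -subr_eq0 -opprD oppr_eq0 -mulr2n mulrn_eq0 /= => /eqP.
Qed.

End hermitian_form.

(** * Indexing of stacked blocks *)

Section stacked_vectors.

Lemma stackE (T : Type) (M K : nat) (b : 'I_M -> 'cV[T]_K) m a :
  stack b (mxvec_index m a) ord0 = b m a ord0.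
Proof. by rewrite mxE mxvecE mxE. Qed.

Lemma blockE (T : Type) (M K : nat) (v : 'cV[T]_(M * K)) m a :
  block v m a ord0 = v (mxvec_index m a) ord0.
Proof. by rewrite !mxE. Qed.

Lemma blockK (T : Type) (M K : nat) (v : 'cV[T]_(M * K)) : stack (block v) = v.
Proof.
by apply/colP => e; case/mxvec_indexP: e => m a; rewrite stackE blockE.
Qed.

Lemma sum_mxvec_index (V : nmodType) (M K : nat) (F : 'I_(M * K) -> V) :
  \sum_e F e = \sum_(m < M) \sum_(a < K) F (mxvec_index m a).
Proof.
rewrite (reindex _ (curry_mxvec_bij M K)) pair_bigA /=.
by apply: eq_bigr => -[].
Qed.

End stacked_vectors.

Lemma real_cV_dot (R : realType) p (v w : 'cV[R[i]]_p) :
  ((real_cV v)^T *m real_cV w) ord0 ord0 =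
  \sum_(e < p) complex.Re (Num.conj (v e ord0) * w e ord0).
Proof.
rewrite mxE big_split_ord /= -big_split; apply: eq_bigr => e _.
rewrite /= [(real_cV v)^T _ (lshift _ _)]mxE [(real_cV v)^T _ (rshift _ _)]mxE.
rewrite !col_mxEu !col_mxEd !mxE [in RHS]mulrC complex_ReMconj.
by congr (_ + _); rewrite mulrC.
Qed.

Lemma int_periodic (T : Type) (f : int -> T) (p : int) :
  (forall m, f (m + p) = f m) -> forall k m, f (m + k * p) = f m.
Proof.
move=> fp; elim=> [|k IH|k IH] m; first by rewrite mul0r addr0.
  by rewrite intS mulrDl mul1r addrCA addrC fp IH.
by rewrite -[LHS]fp -(IH m); congr f; rewrite intS; ring.
Qed.

Section noise_blocks.
Context (R : realType).
Variables (N M K Lch Lz Pz : nat) (n : int) (cz : int -> int -> R[i]).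
Hypotheses (hLz : (Lz <= Lch)%N) (hN : (Lch < N)%N) (hK : K = (N - Lch)%N).
Hypothesis hPz : (Pz %| N)%N.
Hypothesis cz_periodic : forall m l : int, cz (m + Pz%:Z) l = cz m l.
Hypothesis cz_support : forall m l : int, Lz%:Z < `|l| -> cz m l = 0.

Definition block_time (m a : nat) : int := (n * M%:Z - m%:Z) * N%:Z - a%:Z.

Definition stacked_time (e : 'I_(M * K)) : int :=
  stack (fun m : 'I_M => \col_(a < K) block_time m a) e ord0.

Lemma stacked_timeE m a : stacked_time (mxvec_index m a) = block_time m a.
Proof. by rewrite /stacked_time stackE mxE. Qed.

Definition stacked_covariance : 'M[R[i]]_(M * K) :=
  \matrix_(e, e') cz (stacked_time e') (stacked_time e - stacked_time e').

(** Inside a block, the block offset is a multiple of [N], hence a period of [cz]. Times in distinct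
    blocks differ by at least [N - (K - 1) = Lch + 1], which exceeds [Lz]. *)
Lemma stacked_covarianceE m a m' a' :
  stacked_covariance (mxvec_index m a) (mxvec_index m' a') =
  if m == m' then noise_matrix K cz a a' else 0.
Proof.
rewrite mxE !stacked_timeE /block_time; case: eqVneq => [<-|mm'].
  rewrite mxE -(divnK hPz) PoszM mulrA [X in cz X]addrC.
  rewrite (int_periodic (f := fun x => cz x _)) //; congr cz; ring.
rewrite cz_support //.
have ha : (a < N - Lch)%N by rewrite -hK.
have ha' : (a' < N - Lch)%N by rewrite -hK.
have {}mm' : (m : nat) != m' by [].
(* Naming the block difference [d] isolates the only nonlinear fact, the bound on [d * N]; the rest
   is linear arithmetic. *)
have [d [dE d1]] : exists d : int, m%:Z - m'%:Z = d /\ (d <= -1 \/ 1 <= d)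
  by exists (m%:Z - m'%:Z); split => //; lia.
have -> : (n * M%:Z - m%:Z) * N%:Z - a%:Z - ((n * M%:Z - m'%:Z) * N%:Z - a'%:Z)
  = - d * N%:Z + a'%:Z - a%:Z.
  by rewrite -dE; ring.
have [dN|dN] : - d * N%:Z <= - N%:Z \/ N%:Z <= - d * N%:Z.
    by case: d1; [right|left]; nia.
  lia.
lia.
Qed.

Lemma stacked_covariance_mul (w : 'I_M -> 'cV[R[i]]_K) :
  stacked_covariance *m stack w = stack (fun m => noise_matrix K cz *m w m).
Proof.
apply/colP => e; case/mxvec_indexP: e => m a.
rewrite stackE mxE sum_mxvec_index (bigD1 m) //= [X in _ + X]big1 ?addr0.
  by rewrite mxE; apply: eq_bigr => a' _;
    rewrite stacked_covarianceE eqxx stackE.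
move=> m' mm'; apply: big1 => a' _.
by rewrite stacked_covarianceE eq_sym (negbTE mm') mul0r.
Qed.

Definition noise_weight (v : 'cV[R[i]]_(M * K)) : R :=
  expR (- \sum_(m < M) complex.Re
    (inverse_form (noise_matrix K cz) (block v m))).

Variable S : 'M[R]_(M * K + M * K).
Hypothesis cz_invertible : noise_matrix K cz \in unitmx.
Hypothesis SE : forall e e', let c := stacked_covariance e e' in
    [/\ S (lshift _ e) (lshift _ e') = complex.Re c / 2,
        S (rshift _ e) (rshift _ e') = complex.Re c / 2,
        S (rshift _ e) (lshift _ e') = complex.Im c / 2 &
        S (lshift _ e) (rshift _ e') = - (complex.Im c / 2)].

(** [C_z^-1] applied blockwise. By [SW], [2 *: real_cV (W v)] solves the linear system for [S]
    before [S] is known to be invertible. *)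
Let W (v : 'cV[R[i]]_(M * K)) : 'cV[R[i]]_(M * K) :=
  stack (fun m => invmx (noise_matrix K cz) *m block v m).

Let SW v : S *m (2 *: real_cV (W v)) = real_cV v.
Proof.
rewrite -scalemxAr (real_covariance_mul SE) stacked_covariance_mul scalerA.
rewrite divff ?scale1r//; congr real_cV; rewrite -[RHS]blockK; congr stack.
by apply/funext => m; rewrite mulKVmx.
Qed.

(** Solving the system for each basis vector assembles a right inverse of [S]. *)
Lemma stacked_covariance_unit : S \in unitmx.
Proof.
pose X := \matrix_(i, j) (2 *: real_cV (W (complex_cV (col j 1%:M)))) i ord0.
suff /mulmx1_unit[] : S *m X = 1%:M by [].
apply/matrixP => i j; have /colP/(_ i) := SW (complex_cV (col j 1%:M)).
rewrite complex_cVK [col j _ _ _]mxE => <-; rewrite !mxE.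
by apply: eq_bigr => l _; rewrite [X _ _]mxE.
Qed.

(** The factor [2] in the solution of the system for [S] cancels the [1/2] in the Gaussian exponent,
    leaving the complex forms with coefficient one. *)
Lemma gauss_weight_noise v : gauss_weight S (real_cV v) = noise_weight v.
Proof.
rewrite /gauss_weight /noise_weight; congr (expR (- _)).
rewrite -{2}(SW v) -mulmxA mulKmx ?stacked_covariance_unit//.
rewrite -scalemxAr mxE mulrA mulVf// mul1r real_cV_dot sum_mxvec_index.
apply: eq_bigr => m _; rewrite -Re_sum; congr complex.Re.
rewrite /inverse_form -mulmxA mxE; apply: eq_bigr => a _.
by rewrite /W stackE !mxE.
Qed.

End noise_blocks.

(** * Integration and translation on complex vectors *)

Section lebesgue_complex_vectors.
Local Open Scope ereal_scope.
Context (R : realType) (n : nat).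
Notation TR := (measurableTypeR R).
Notation mu := (@lebesgue_measure R).

Lemma ge0_integral_lebesgue_cV (F : 'cV[R[i]]_n -> \bar R) :
  measurable_fun setT F -> (forall v, 0 <= F v) ->
  \int[lebesgue_cV R n]_v F v = \int[power_measure mu (n + n)]_u F
    (complex_cV u).
Proof.
move=> mF F0.
transitivity (\int[pushforward (power_measure mu (n + n))
  (@complex_cV R n : 'cV[TR]_(n + n) -> _)]_v F v).
  by apply: eq_measure_integral; first exact: measurable_complex_cV.
by rewrite (ge0_integral_pushforward (@measurable_complex_cV R n)
  (power_measure mu (n + n)) measurableT mF (fun v _ => F0 v)) preimage_setT.
Qed.

Lemma measurable_real_cV : measurable_fun setT
  (@real_cV R n : _ -> 'cV[TR]_(n + n)).
Proof.
apply: measurable_to_cV => i; rewrite -(splitK i);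
  case: (fintype.split i) => j /=.
  under eq_fun do rewrite col_mxEu !mxE.
  exact: (measurableT_comp (@measurable_Re R) (measurable_coord _)).
under eq_fun do rewrite col_mxEd !mxE.
exact: (measurableT_comp (@measurable_Im R) (measurable_coord _)).
Qed.

Lemma real_cVD (v a : 'cV[R[i]]_n) : real_cV (v + a)%R =
  (real_cV v + real_cV a)%R.
Proof. by rewrite /real_cV add_col_mx -!map_mxD. Qed.

Lemma complex_cVD (u : 'cV[R]_(n + n)) (a : 'cV[R[i]]_n) :
  complex_cV (u + real_cV a)%R = (complex_cV u + a)%R.
Proof. by rewrite -{2}(real_cVK a) -[RHS]real_cVK real_cVD complex_cVK real_cVK.
  Qed.

Lemma measurable_complex_cV_addr (a : 'cV[R[i]]_n) :
  measurable_fun setT (fun v : 'cV[R[i]]_n => (v + a)%R : 'cV[R[i]]_n).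
Proof.
have -> : (fun v : 'cV[R[i]]_n => (v + a)%R : 'cV[R[i]]_n) =
    (fun v => complex_cV (real_cV v + real_cV a)%R).
  by apply/funext => v; rewrite complex_cVD real_cVK.
apply: (measurableT_comp (@measurable_complex_cV R n)).
exact: (measurableT_comp (measurable_cV_addr (real_cV a)) measurable_real_cV).
Qed.

Lemma ge0_integral_lebesgue_cVD (F : 'cV[R[i]]_n -> \bar R) (a : 'cV[R[i]]_n) :
  measurable_fun setT F -> (forall v, 0 <= F v) ->
  \int[lebesgue_cV R n]_v F (v + a)%R = \int[lebesgue_cV R n]_v F v.
Proof.
move=> mF F0.
have mFa : measurable_fun setT (fun v : 'cV[R[i]]_n => F (v + a)%R).
  exact: (measurableT_comp mF (measurable_complex_cV_addr a)).
rewrite (ge0_integral_lebesgue_cV mF F0) (ge0_integral_lebesgue_cV mFa) => [|v];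
  last exact: F0.
have mFc : measurable_fun setT (fun u : 'cV[TR]_(n + n) => F (complex_cV u)).
  exact: (measurableT_comp mF (@measurable_complex_cV R n)).
rewrite -(ge0_integral_power_lebesgueD (real_cV a) mFc) => [|v]; last exact: F0.
by apply: eq_integral => u _; rewrite complex_cVD.
Qed.

End lebesgue_complex_vectors.

Section noise_density.
Context d (Omega : measurableType d) (R : realType) (P : probability Omega R).
Notation TR := (measurableTypeR R).
Notation mu := (@lebesgue_measure R).
Variables (N M K Lch Lz Pz : nat) (n : int) (cz : int -> int -> R[i])
  (Z : int -> Omega -> R[i]).
Hypotheses (hLz : (Lz <= Lch)%N) (hN : (Lch < N)%N) (hK : K = (N - Lch)%N).
Hypothesis hPz : (Pz %| N)%N.
Hypothesis cz_periodic : forall m l : int, cz (m + Pz%:Z) l = cz m l.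
Hypothesis cz_support : forall m l : int, Lz%:Z < `|l| -> cz m l = 0.
Hypothesis cz_invertible : noise_matrix K cz \in unitmx.
Hypothesis mZ : forall k, measurable_fun setT (Z k).
Hypothesis noiseZ : proper_gaussian_noise P cz Z.

Definition noise_vector (w : Omega) : 'cV[R[i]]_(M * K) :=
  \col_e Z (stacked_time N n e) w.

(* It depends on [cz] only, hence is the same under both hypotheses and cancels in
   the likelihood ratio. *)
Definition noise_mass : R :=
  fine (\int[lebesgue_cV R (M * K)]_v (noise_weight cz v)%:E)%E.

(** Sampled at the times [0, -1, ..., -(K - 1)], the noise has exactly this matrix as its complex
    covariance. *)
Lemma noise_matrix_hermitian : map_mx Num.conj (noise_matrix K cz)^T =
  noise_matrix K cz.
Proof.
have [k [A [_ SE]]] := noise_law mZ noiseZ (fun a : 'I_K => - (a : nat)%:Z).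
apply: (real_covariance_hermitian (S := A *m A^T)) => [i j|]; last first.
  by rewrite trmx_mul trmxK.
by have := SE i j; rewrite /= !mxE opprK [- _ + _]addrC.
Qed.

Lemma measurable_noise_vector : measurable_fun setT noise_vector.
Proof. by apply: measurable_to_cV => i; under eq_fun do rewrite mxE;
  exact: mZ. Qed.

(** [gaussian_cV] admits degenerate laws. Invertibility of [noise_matrix] passes to the real
    covariance [A *m A^T], which is what the density of the image requires. *)
Lemma noise_vector_density : 0 < noise_mass /\
  is_density P noise_vector (fun v => noise_mass^-1 * noise_weight cz v).
Proof.
have [k [A [law SE']]] := noise_law mZ noiseZ (stacked_time N n : 'I_(M * K) ->
  int).
have SE e e' : let c := @stacked_covariance R N M K n cz e e' in
    [/\ (A *m A^T) (lshift _ e) (lshift _ e') = complex.Re c / 2,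
        (A *m A^T) (rshift _ e) (rshift _ e') = complex.Re c / 2,
        (A *m A^T) (rshift _ e) (lshift _ e') = complex.Im c / 2 &
        (A *m A^T) (lshift _ e) (rshift _ e') = - (complex.Im c / 2)].
  by rewrite /stacked_covariance mxE; exact: SE'.
have Su := stacked_covariance_unit hLz hN hK hPz cz_periodic cz_support
  cz_invertible SE.
have weightE := gauss_weight_noise hLz hN hK hPz cz_periodic cz_support
  cz_invertible SE.
have [W0 lawA] := gaussian_image_density_normalized Su.
have weightE' y : gauss_weight (A *m A^T) y = noise_weight cz (complex_cV y).
  by rewrite -weightE complex_cVK.
have mweight : measurable_fun setT (noise_weight cz : 'cV[R[i]]_(M * K) -> R).
  rewrite (_ : noise_weight cz = gauss_weight (A *m A^T) \o @real_cV R (M * K));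
    last first.
    by apply/funext => v /=; rewrite weightE.
  exact: (measurableT_comp (measurable_gauss_weight _)
    (@measurable_real_cV R (M * K))).
have massE : noise_mass = fine
  (\int[power_measure mu (M * K + M * K)]_y (gauss_weight (A *m A^T) y)%:E)%E.
  rewrite /noise_mass ge0_integral_lebesgue_cV //.
  - by congr fine; apply: eq_integral => y _; rewrite weightE'.
  - exact/measurable_EFinP.
  - by move=> v; rewrite lee_fin expR_ge0.
rewrite massE; split=> //; split=> [|r|B mB].
- exact: measurable_funM.
- by rewrite mulr_ge0 ?expR_ge0// invr_ge0 ltW.
(* The law is known for real coordinates, so the indicator of [B] is read through [complex_cV]. *)
pose F (y : 'cV[TR]_(M * K + M * K)) : \bar R := (\1_B (complex_cV y))%:E.
have mF : measurable_fun setT F.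
  apply/measurable_EFinP; apply: (measurableT_comp (measurable_indic mB)).
  exact: measurable_complex_cV.
have F0 y : (0 <= F y)%E by rewrite lee_fin.
transitivity (\int[P]_w F (real_cV (noise_vector w)))%E.
  rewrite -(setIT (_ @^-1` _)) -integral_indic //.
    apply: eq_integral => w _; rewrite /F real_cVK.
    by rewrite !indicE.
  by rewrite -[X in measurable X]setTI; exact: measurable_noise_vector.
rewrite (ge0_integral_gaussian_vector (measurable_real_noise mZ _) law mF F0).
under eq_integral do rewrite addr0.
rewrite lawA //.
set c := (fine _)^-1.
transitivity (\int[lebesgue_cV R (M * K)]_v
  ((c * noise_weight cz v)%:E * (\1_B v)%:E))%E.
  rewrite ge0_integral_lebesgue_cV //.
  - by apply: eq_integral => y _; rewrite muleC weightE'.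
  - apply: emeasurable_funM; apply/measurable_EFinP;
      last exact: measurable_indic.
    exact: measurable_funM.
  - by move=> v; rewrite mule_ge0// lee_fin mulr_ge0 ?expR_ge0// invr_ge0 ltW.
by rewrite [RHS]integral_mkcond epatch_indic.
Qed.

End noise_density.

(** * Mixtures over the data symbols *)

Section mixture_density.
Context d (Omega : measurableType d) (R : realType) (P : probability Omega R).
Variables (n L : nat) (V X : Omega -> 'cV[R[i]]_n) (phi : 'cV[R[i]]_n -> R).
Variables (E : 'I_L -> set Omega) (v : 'I_L -> 'cV[R[i]]_n).
Hypothesis L_gt0 : (0 < L)%N.
Hypothesis densV : is_density P V phi.
Hypotheses (mV : measurable_fun setT V) (mX : measurable_fun setT X).
Hypothesis mE : forall l, measurable (E l).
Hypothesis tE : trivIset setT E.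
Hypothesis PE : forall l, P (E l) = (L%:R^-1)%:E.
Hypothesis indE : forall l B, measurable B ->
  P (E l `&` V @^-1` B) = (P (E l) * P (V @^-1` B))%E.
Hypothesis XE : forall l, {ae P, forall w, E l w -> X w = v l + V w}.

(** The events [E l] partition the space up to a null set, and on each of them [X] is almost surely
    a translate of [V] by a constant, with [V] independent of the event. *)
Lemma mixture_density :
  is_density P X (fun r => L%:R^-1 * \sum_l phi (r - v l)).
Proof.
have [mphi phi0 Vphi] := densV.
have mEphi : measurable_fun setT (EFin \o phi) by exact/measurable_EFinP.
have mphil l : measurable_fun setT (fun r : 'cV[R[i]]_n => phi (r - v l)).
  exact: (measurableT_comp mphi (measurable_complex_cV_addr (- v l))).
split=> [|r|B mB].
- apply: measurable_funM => //; exact: measurable_sum.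
- by rewrite mulr_ge0 ?invr_ge0// sumr_ge0.
have mXB : measurable (X @^-1` B) by rewrite -[X in measurable X]setTI;
  exact: mX.
pose U := \big[setU/set0]_(l < L) E l.
have mU : measurable U by apply: bigsetU_measurable.
have PU : P U = 1%E.
  rewrite measure_bigsetU_ord // (eq_bigr _ (fun l _ => PE l)).
  rewrite sumEFin; congr EFin; rewrite sumr_const card_ord -[LHS]mulr_natl.
  by rewrite divff// pnatr_eq0 -lt0n.
(* The [L] disjoint events of probability [1 / L] exhaust the total mass. *)
have PUC : P (~` U) = 0%E by rewrite probability_setC// PU subee.
transitivity (\sum_(l < L) P (E l `&` X @^-1` B))%E.
  rewrite -measure_bigsetU_ord //; last 2 first.
  - by move=> l; exact: measurableI.
  - by apply: trivIset_setIr.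
  have -> : \big[setU/set0]_(l < L) (E l `&` X @^-1` B) = U `&` X @^-1` B.
    by rewrite /U big_distrl.
  rewrite -{1}(setTI (X @^-1` B)) -(setUv U) setIUl measureU //.
  - rewrite [X in (_ + X)%E](_ : _ = 0%E) ?adde0//.
    by apply: (subset_measure0 (B := ~` U)) => //;
      [exact: measurableI (measurableC mU) _|exact: measurableC].
  - exact: measurableI.
  - by apply: measurableI => //; exact: measurableC.
  - by rewrite setIACA setICr set0I.
(* Independence factors out [P (E l)]; translation invariance of Lebesgue measure then moves the
   shift from the set [B] to the argument of [phi]. *)
have shiftE l : P (E l `&` X @^-1` B) =
    (\int[lebesgue_cV R n]_(r in B) (L%:R^-1 * phi (r - v l))%:E)%E.
  pose Bl := (fun r : 'cV[R[i]]_n => r + v l) @^-1` B.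
  have mBl : measurable Bl.
    rewrite -[X in measurable X]setTI.
    exact: (measurable_complex_cV_addr (v l)).
  transitivity (P (E l `&` V @^-1` Bl)).
    have mVB : measurable (V @^-1` Bl) by rewrite -[X in measurable X]setTI;
      exact: mV.
    have indicP A : measurable A -> P A = (\int[P]_w (\1_A w)%:E)%E.
      by move=> mA; rewrite integral_indic// setIT.
    rewrite (indicP (E l `&` X @^-1` B)); last exact: measurableI.
    rewrite (indicP (E l `&` V @^-1` Bl)); last exact: measurableI.
    apply: ge0_ae_eq_integral => //.
    - by apply/measurable_EFinP; apply: measurable_indic; exact: measurableI.
    - by apply/measurable_EFinP; apply: measurable_indic; exact: measurableI.
    apply: filterS (XE l) => w Xw _; congr EFin.
    rewrite !indicE; congr (_%:R); congr nat_of_bool.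
    apply/idP/idP; rewrite !inE => -[Elw]; rewrite /Bl /preimage /= => Bw;
      split=> //.
      by rewrite /= addrC -Xw.
    by rewrite /= Xw // addrC.
  rewrite indE // PE Vphi //.
  rewrite integral_mkcond epatch_indic [in RHS]integral_mkcond epatch_indic.
  pose F (r : 'cV[R[i]]_n) : \bar R := ((phi (r - v l))%:E * (\1_B r)%:E)%E.
  have mF : measurable_fun setT F.
    by apply: emeasurable_funM; apply/measurable_EFinP => //;
      exact: measurable_indic.
  have F0 r : (0 <= F r)%E by rewrite mule_ge0// lee_fin.
  transitivity ((L%:R^-1)%:E * \int[lebesgue_cV R n]_r F r)%E.
    congr (_ * _)%E; rewrite -(ge0_integral_lebesgue_cVD (v l) mF F0).
    by apply: eq_integral => r _; rewrite /F addrK.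
  transitivity (\int[lebesgue_cV R n]_r ((L%:R^-1)%:E * F r))%E.
    by rewrite (ge0_integralZl _ _ mF)// lee_fin invr_ge0.
  by apply: eq_integral => r _; rewrite /F /= EFinM muleA.
rewrite (eq_bigr _ (fun l _ => shiftE l)) -ge0_integral_sum //.
- by apply: eq_integral => r _; rewrite sumEFin mulr_sumr.
- by move=> l; apply: measurable_funTS; apply/measurable_EFinP;
    exact: measurable_funM.
- by move=> l r _; rewrite lee_fin mulr_ge0// invr_ge0.
Qed.

End mixture_density.

(** With [x = m * w], this turns the two-stage decoding in [data_digit] (block, then symbol) into
    reading a plain base-[b] digit. *)
Lemma divn_modn_expn b x w j l : (j < w)%N ->
  (l %/ b ^ x %% b ^ w %/ b ^ j %% b = l %/ b ^ (x + j) %% b)%N.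
Proof.
move=> jw; rewrite -(subnK (ltnW jw)) expnD -modn_divl -divnMA -expnD.
by rewrite modn_dvdm// -{1}(expn1 b) dvdn_exp2l// subn_gt0.
Qed.

Lemma digits_inj b q l l' : (l < b ^ q)%N -> (l' < b ^ q)%N ->
  (forall i, (i < q)%N -> (l %/ b ^ i %% b = l' %/ b ^ i %% b)%N) -> l = l'.
Proof.
elim: q l l' => [|q IH] l l'; first by rewrite expn0 !ltnS !leqn0 => /eqP->
  /eqP->.
case: b IH => [|b] IH; first by rewrite exp0n.
move=> lq l'q H; rewrite (divn_eq l b.+1) (divn_eq l' b.+1).
have := H 0%N isT; rewrite !divn1 => ->; congr (_ * _ + _)%N; apply: IH.
- by rewrite ltn_divLR// -expnSr.
- by rewrite ltn_divLR// -expnSr.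
- by move=> i iq; rewrite -!divnMA -!expnS; exact: H.
Qed.

Lemma measurable_complex_set1 (R : realType) (x : R[i]) : measurable [set x].
Proof.
rewrite [measurable _](_ : _ = measurable
  ([set complex.Re x] `*` [set complex.Im x])).
  exact: measurableX.
rewrite /measurable /= /measurable_complex /=; congr (measurable _).
by apply/seteqP; split=> -[a b]; rewrite /complex_of_pair /=;
  case: x => c e /= [-> ->].
Qed.

(** * Events that prescribe all data symbols of the window *)

Section data_configurations.
Context d (Omega : measurableType d) (R : realType) (P : probability Omega R).
Variables (N M w off : nat) (n : int) (s : seq R[i])
  (S Z : int -> Omega -> R[i]).
Let Ns := size s.
Hypotheses (Ns_gt0 : (0 < Ns)%N) (s_distinct : uniq s)
  (offN : (off + w <= N)%N).
Hypothesis mS : forall k, measurable_fun setT (S k).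
Hypothesis dataS : data_symbols P s
  [set k | exists (m : 'I_M) (j : 'I_w), k = symbol_time N M n m (off + j)] S Z.

Let site (p : 'I_M * 'I_w) : int := symbol_time N M n p.1 (off + p.2).

(* The configuration number [l < Ns ^ (M * w)] is read in base [Ns], the [j]-th
   symbol of block [m] being its digit number [m * w + j]. *)
Definition data_digit (l m j : nat) : R[i] :=
  s`_(l %/ Ns ^ (m * w) %% Ns ^ w %/ Ns ^ j %% Ns).

Definition data_event (l : nat) : set Omega :=
  [set x | forall (m : 'I_M) (j : 'I_w),
    S (symbol_time N M n m (off + j)) x = data_digit l m j].

(** Positions inside a block stay below [N], so Euclidean division by [N] recovers the block and the
    position. *)
Let site_inj : injective site.
Proof.
move=> [m j] [m' j'] /eqP; rewrite /site /symbol_time /= => /eqP E.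
have e : (m * N + (off + j) = m' * N + (off + j'))%N by lia.
have jN (i : 'I_w) : (off + i < N)%N by apply: leq_trans offN;
  rewrite ltn_add2l.
have N0 : (0 < N)%N by apply: leq_ltn_trans (jN j).
have em : (m = m' :> nat).
  move/(congr1 (divn^~ N)): e; rewrite !divnMDl// !divn_small// !addn0.
  by [].
have ej : (j = j' :> nat) by move: e; rewrite em => /addnI/addnI.
by congr (_, _); exact/val_inj.
Qed.

Let preimage_digit l p := S (site p) @^-1` [set data_digit l p.1 p.2].

Let data_eventE l : data_event l = \bigcap_(p in setT) preimage_digit l p.
Proof.
apply/seteqP; split=> x Ex => [p _|m j]; first exact: Ex.
exact: (Ex (m, j) I).
Qed.

Lemma measurable_data_event l : measurable (data_event l).
Proof.
rewrite data_eventE; apply: fin_bigcap_measurable => // p _.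
rewrite -[X in measurable X]setTI; apply: mS => //.
exact: measurable_complex_set1.
Qed.

Lemma data_event_probability l :
  P (data_event l) = ((Ns ^ (M * w))%:R^-1)%:E.
Proof.
pose ks := [seq site p | p <- enum {: 'I_M * 'I_w}].
(* Independence expects one measurable set per integer time: by injectivity of [site] this is a
   singleton at the data times, and it is the whole space elsewhere. *)
pose B k := [set x | forall p, site p = k -> x = data_digit l p.1 p.2].
have BE p : B (site p) = [set data_digit l p.1 p.2].
  apply/seteqP; split=> x; first by move/(_ p erefl).
  by move=> -> q /site_inj ->.
have -> : data_event l = \bigcap_(k in [set` ks]) (S k @^-1` B k).
  apply/seteqP; split=> x Ex.
    by move=> k /= /mapP[p _ ->]; rewrite /preimage BE; exact: Ex.
  move=> m j; have := Ex (site (m, j)); rewrite /preimage /= BE; apply.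
  by apply/map_f; rewrite mem_enum.
rewrite (data_independent dataS).
- rewrite big_map big_enum /=.
  rewrite (eq_bigr (fun=> (Ns%:R^-1)%:E)) => [|p _]; last first.
    rewrite BE (data_uniform dataS) //; first by exists p.1, p.2.
    by apply: mem_nth; rewrite ltn_pmod.
  by rewrite prodEFin prodr_const card_prod !card_ord exprVn natrX.
- by rewrite map_inj_uniq ?enum_uniq.
- by move=> k /mapP[p _ ->]; exists p.1, p.2.
- move=> k; have [[p pk]|nk] := pselect (exists p, site p = k).
    by rewrite -pk BE; exact: measurable_complex_set1.
  rewrite (_ : B k = setT) //; apply/seteqP; split=> // x _ p pk.
  by case: nk; exists p.
Qed.

(** An outcome in two of the events gives both numbers the same symbols; as the constellation points
    are distinct, the numbers then share all their digits. *)
Lemma data_event_trivIset :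
  trivIset setT (fun l : 'I_(Ns ^ (M * w)) => data_event l).
Proof.
move=> l l' _ _ [x [El El']]; apply/val_inj.
apply: (digits_inj (ltn_ord l) (ltn_ord l')) => i iMw.
have w0 : (0 < w)%N by case: (w) iMw; rewrite ?muln0.
have im : (i %/ w < M)%N by rewrite ltn_divLR.
have ij : (i %% w < w)%N by rewrite ltn_pmod.
have := El (Ordinal im) (Ordinal ij); rewrite (El' (Ordinal im) (Ordinal ij)).
rewrite /data_digit /= !divn_modn_expn // -divn_eq => /esym/eqP.
by rewrite nth_uniq// ?ltn_pmod// => /eqP.
Qed.

Lemma data_event_independent l k (t : 'I_k -> int) (B : set 'cV[R[i]]_k) :
  measurable B ->
  let V x := \col_e Z (t e) x in
  P (data_event l `&` V @^-1` B) = (P (data_event l) * P (V @^-1` B))%E.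
Proof.
move=> mB V; apply: (data_noise_independent dataS).
- pose G := \bigcup_(k in [set k | exists (m : 'I_M) (j : 'I_w),
    k = symbol_time N M n m (off + j)])
    preimage_set_system setT (S k) measurable.
  suff : @measurable _ (g_sigma_algebraType G) (data_event l) by [].
  rewrite data_eventE; apply: fin_bigcap_measurable => // p _.
  apply: sub_sigma_algebra; exists (site p); first by exists p.1, p.2.
  exists [set data_digit l p.1 p.2]; first exact: measurable_complex_set1.
  by rewrite setTI.
- pose G := \bigcup_(k in [set: int]) preimage_set_system setT (Z k) measurable.
  suff : @measurable _ (g_sigma_algebraType G) (V @^-1` B) by [].
  rewrite -[X in measurable X]setTI.
  (* Measurability of [V] is needed for the sigma-algebra generated by the noise, not merely for
     that of [Omega]. *)
  have mV : measurable_fun [set: g_sigma_algebraType G]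
    (V : g_sigma_algebraType G -> _).
    apply: measurable_to_cV => i; under eq_fun do rewrite mxE.
    move=> _ C mC; apply: sub_sigma_algebra; exists (t i) => //.
    by exists C.
  exact: mV.
Qed.

End data_configurations.

(** * Likelihoods of the received vector *)

(** Both functions have the same integral over every measurable set, and [f] is integrable because
    its total mass is one. *)
Lemma density_ae_unique d (Omega : measurableType d) (R : realType)
    (P : probability Omega R) n (X : Omega -> 'cV[R[i]]_n)
      (f g : 'cV[R[i]]_n -> R) :
  is_density P X f -> is_density P X g ->
  {ae lebesgue_cV R n, forall r, f r = g r}.
Proof.
move=> [mf f0 fE] [mg g0 gE].
have : ae_eq (lebesgue_cV R n) setT (EFin \o f) (EFin \o g).
  apply: integral_ae_eq => //.
  - apply/integrableP; split; first exact/measurable_EFinP.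
    under eq_integral do rewrite /= ger0_norm//.
    by rewrite -fE// preimage_setT probability_setT ltry.
  - exact/measurable_EFinP.
  - by move=> A _ mA; rewrite -fE// -gE.
by apply: filterS => r /(_ I) [].
Qed.

Lemma measurable_complex_parts (R : realType) d (T : measurableType d)
  (f : T -> R[i]) :
  measurable_fun setT (fun x => complex.Re (f x)) ->
  measurable_fun setT (fun x => complex.Im (f x)) -> measurable_fun setT f.
Proof.
move=> mRe mIm.
rewrite (_ : f = @complex_of_pair R \o
  (fun x => (complex.Re (f x), complex.Im (f x)))).
  apply: (measurableT_comp (@measurable_complex_of_pair R)).
  exact: measurable_fun_pair.
by apply/funext => x /=; rewrite /complex_of_pair /=; case: (f x).
Qed.

Section transmission_model.
Context d (Omega : measurableType d) (R : realType).
Variables (N M K Lch Ph : nat) (n : int) (h : int -> int -> R[i]).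
Variables (S Z : int -> Omega -> R[i]).
Hypotheses (hN : (Lch < N)%N) (hK : K = (N - Lch)%N) (hPh : (Ph %| N)%N).
Hypothesis h_periodic : forall m l : int, h (m + Ph%:Z) l = h m l.
Hypothesis mS : forall k, measurable_fun setT (S k).
Hypothesis mZ : forall k, measurable_fun setT (Z k).

Lemma measurable_received k : measurable_fun setT (received Lch h S Z k).
Proof.
have mRe := @measurable_Re R; have mIm := @measurable_Im R.
apply: measurable_complex_parts.
  under eq_fun do rewrite /received raddfD /= Re_sum.
  apply: measurable_funD; last exact: (measurableT_comp mRe (mZ k)).
  apply: measurable_sum => l; under eq_fun do rewrite complex_ReM.
  by apply: measurable_funB; apply: measurable_funM => //;
    [apply: (measurableT_comp mRe)|apply: (measurableT_comp mIm)].
under eq_fun do rewrite /received raddfD /= Im_sum.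
apply: measurable_funD; last exact: (measurableT_comp mIm (mZ k)).
apply: measurable_sum => l; under eq_fun do rewrite complex_ImM.
by apply: measurable_funD; apply: measurable_funM => //;
  [apply: (measurableT_comp mIm)|apply: (measurableT_comp mRe)].
Qed.

Lemma measurable_post_processed :
  measurable_fun setT (post_processed N M K Lch n h S Z).
Proof.
apply: measurable_to_cV => e; case/mxvec_indexP: e => m a.
under eq_fun do rewrite /post_processed stackE mxE.
exact: measurable_received.
Qed.

Lemma channel_matrix_mul (g : 'cV[R[i]]_N) (G : nat -> R[i]) (a : 'I_K) :
  (forall c : 'I_N, g c ord0 = G c) ->
  (channel_matrix N K Lch h *m g) a ord0 = \sum_(l < Lch.+1) h (- a%:Z) l%:Z * G
    (a + l)%N.
Proof.
move=> gG; rewrite mxE.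
(* Since [a < K], the channel memory starting at column [a] ends inside the block: this is why [Lch]
   samples per block are discarded. *)
have aN : (a + Lch.+1 <= N)%N.
  have : (a < N - Lch)%N by rewrite -hK.
  by lia.
transitivity (\sum_(0 <= c < N)
    if (a <= c <= a + Lch)%N then h (- a%:Z) (c%:Z - a%:Z) * G c else 0).
  rewrite big_mkord; apply: eq_bigr => c _; rewrite mxE gG.
  by case: ifP => _; rewrite ?mul0r.
rewrite (big_cat_nat (n := a)) //=; last by lia.
rewrite big_nat_cond big1 ?add0r => [|c]; last first.
  by case: ifP => //; lia.
rewrite (big_cat_nat (n := (a + Lch.+1)%N)) //=; last by lia.
rewrite [X in _ + X]big_nat_cond [X in _ + X]big1 ?addr0 => [|c]; last first.
  by case: ifP => //; lia.
rewrite -{1}[a : nat]add0n big_addn addKn big_mkord; apply: eq_bigr => l _.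
rewrite ifT; last by have := ltn_ord l; lia.
by rewrite addnC; congr (h _ _ * _); lia.
Qed.

Lemma post_processedE (g : 'I_M -> 'cV[R[i]]_N) x :
  (forall (m : 'I_M) (c : 'I_N), S (symbol_time N M n m c) x = g m c ord0) ->
  post_processed N M K Lch n h S Z x =
  stack (fun m => channel_matrix N K Lch h *m g m) + noise_vector N M K n Z x.
Proof.
move=> Sg; apply/colP => e; case/mxvec_indexP: e => m a.
rewrite /post_processed stackE [RHS]mxE stackE
  ![noise_vector _ _ _ _ _ _ _ _]mxE stacked_timeE.
rewrite mxE /received /block_time; congr (_ + _).
have aK : (a < N - Lch)%N by rewrite -hK.
rewrite (@channel_matrix_mul _ (fun c => S (symbol_time N M n m c) x)) => [|c];
  last by rewrite Sg.
apply: eq_bigr => l _; congr (_ * _).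
  (* The block offset is a multiple of [N], hence of the channel period. *)
  rewrite -(divnK hPh) PoszM mulrA addrC.
  exact: (int_periodic (f := fun x => h x _)).
by congr (S _ x); rewrite /symbol_time; lia.
Qed.

End transmission_model.

(** * Densities under each hypothesis *)

Section likelihood_densities.
Context d (Omega : measurableType d) (R : realType).
Variables (Ph Pz Lz Lch N K M : nat).
Hypotheses (hLz : (Lz <= Lch)%N) (hPhN : (Ph %| N)%N) (hPzN : (Pz %| N)%N).
Hypotheses (hN : (Lch < N)%N) (hK : K = (N - Lch)%N).
Variables (h cz : int -> int -> R[i]).
Hypothesis h_periodic : forall m l : int, h (m + Ph%:Z) l = h m l.
Hypothesis cz_periodic : forall m l : int, cz (m + Pz%:Z) l = cz m l.
Hypothesis cz_support : forall m l : int, Lz%:Z < `|l| -> cz m l = 0.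
Hypothesis cz_invertible : noise_matrix K cz \in unitmx.
Variable s : seq R[i].
Let Ns := size s.
Hypotheses (Ns_gt0 : (0 < Ns)%N) (s_distinct : uniq s).
Variables (S Z : int -> Omega -> R[i]).
Hypothesis mS : forall k, measurable_fun setT (S k).
Hypothesis mZ : forall k, measurable_fun setT (Z k).
Variable n : int.

Lemma blockB (u v : 'cV[R[i]]_(M * K)) m : block (u - v) m = block u m - block v
  m.
Proof. by apply/colP => a; rewrite !mxE. Qed.

(** Here [g l] lists all [N] symbols of each block in configuration [l], known ones included. The
    agreement is asked only almost surely, as synchronization symbols are prescribed only up to null
    sets. *)
Lemma configuration_density (P : probability Omega R) (w off : nat)
    (g : nat -> 'I_M -> 'cV[R[i]]_N) :
  proper_gaussian_noise P cz Z -> (off + w <= N)%N ->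
  data_symbols P s [set k | exists (m : 'I_M) (j : 'I_w),
    k = symbol_time N M n m (off + j)] S Z ->
  (forall l, {ae P, forall x, data_event N M w off n s S l x ->
     forall (m : 'I_M) (c : 'I_N), S (symbol_time N M n m c) x = g l m c ord0})
       ->
  is_density P (post_processed N M K Lch n h S Z)
    (fun r => (Ns ^ (M * w))%:R^-1 * ((noise_mass M K cz)^-1 *
       \sum_(l < Ns ^ (M * w)) expR (- \sum_(m < M) complex.Re
         (inverse_form (noise_matrix K cz)
           (block r m - channel_matrix N K Lch h *m g l m))))).
Proof.
move=> noiseZ offN dataS gS.
have [mass0 densV] := noise_vector_density M n hLz hN hK hPzN cz_periodic
  cz_support cz_invertible mZ noiseZ.
have -> : (fun r => (Ns ^ (M * w))%:R^-1 * ((noise_mass M K cz)^-1 *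
       \sum_(l < Ns ^ (M * w)) expR (- \sum_(m < M) complex.Re
         (inverse_form (noise_matrix K cz)
           (block r m - channel_matrix N K Lch h *m g l m))))) =
    (fun r => (Ns ^ (M * w))%:R^-1 * \sum_(l < Ns ^ (M * w))
      (noise_mass M K cz)^-1 *
       noise_weight cz (r - stack
         (fun m => channel_matrix N K Lch h *m g l m))).
  apply/funext => r; congr (_ * _); rewrite mulr_sumr; apply: eq_bigr => l _.
  congr (_ * expR (- _)); apply: eq_bigr => m _.
  by rewrite blockB stackK.
apply: (mixture_density (V := noise_vector N M K n Z)
  (phi := fun v => (noise_mass M K cz)^-1 * noise_weight cz v)
  (E := fun l : 'I_(Ns ^ (M * w)) => data_event N M w off n s S l)
  (v := fun l : 'I_(Ns ^ (M * w)) =>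
    stack (fun m => channel_matrix N K Lch h *m g l m))) => //.
- by rewrite expn_gt0 Ns_gt0.
- exact: measurable_noise_vector.
- exact: measurable_post_processed.
- by move=> l; exact: measurable_data_event.
- exact: data_event_trivIset.
- by move=> l; rewrite (data_event_probability Ns_gt0 s_distinct offN dataS).
- by move=> l B mB; exact: (data_event_independent dataS l (stacked_time N n)
    mB).
- move=> l; apply: filterS (gS l) => x Sx Ex.
  exact: (post_processedE Z hN hK hPhN h_periodic (Sx Ex)).
Qed.

Lemma data_hypothesis_density (P : probability Omega R) :
  proper_gaussian_noise P cz Z -> data_hypothesis N M n P s S Z ->
  is_density P (post_processed N M K Lch n h S Z)
    (fun r => (Ns ^ (M * N))%:R^-1 *
      ((noise_mass M K cz)^-1 * data_sum N Lch s h cz r)).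
Proof.
move=> noiseZ dataS.
rewrite (_ : (fun r => _) = (fun r : 'cV[R[i]]_(M * K) =>
    (Ns ^ (M * N))%:R^-1 * ((noise_mass M K cz)^-1 *
    \sum_(l < Ns ^ (M * N)) expR (- \sum_(m < M) complex.Re
      (inverse_form (noise_matrix K cz) (block r m -
        channel_matrix N K Lch h *m data_vector N s (data_index N s l m)))))));
          last first.
  by apply/funext => r; congr (_ * (_ * _)); rewrite /data_sum [in LHS]mulnC.
apply: (configuration_density (w := N) (off := 0%N)
  (g := fun l m => data_vector N s (data_index N s l m)) noiseZ (leqnn N)
    dataS).
by move=> l; apply: aeW => x Ex m c; rewrite mxE; exact: Ex.
Qed.

Lemma sync_hypothesis_density (P : probability Omega R)
  (fsw : 'cV[R[i]]_(M * K)) :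
  proper_gaussian_noise P cz Z -> sync_hypothesis N Lch n P s fsw S Z ->
  is_density P (post_processed N M K Lch n h S Z)
    (fun r => (Ns ^ (M * Lch))%:R^-1 *
      ((noise_mass M K cz)^-1 * sync_sum N Lch s h cz fsw r)).
Proof.
move=> noiseZ [Sf dataS].
have KL : (K + Lch <= N)%N by rewrite hK subnK// ltnW.
apply: (configuration_density (P := P) (w := Lch) (off := K)
  (g := fun u m => sync_vector N s fsw (sync_index Lch s u m) m) noiseZ KL
    dataS).
move=> u; have {}Sf : {ae P, forall x, forall (m : 'I_M) (a : 'I_K),
    S (symbol_time N M n m a) x = sync_block fsw (rev_ord m) a ord0}.
  by apply: filter_forall => m; apply: filter_forall => a; exact: Sf.
apply: filterS Sf => x Sx Ex m c; rewrite mxE.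
case: insubP => [a _ <-|]; first exact: Sx.
rewrite -leqNgt => Kc.
(* A position at or beyond [K] is the data position [c - K], which lies within the last [Lch]
   entries. *)
have cL : (c - K < Lch)%N by rewrite ltn_subLR// (leq_trans (ltn_ord c))// hK
  subnK// ltnW.
by have := Ex m (Ordinal cL); rewrite /= subnKC.
Qed.

End likelihood_densities.

(** A density is determined only up to a null set: the formula holds at every point for one choice
    of versions, and almost everywhere for any other. The first clause justifies the real parts in
    the two sums. *)
Theorem mainTheorem1
  (R : realType) (d : measure_display) (Omega : measurableType d)
  (P0 P1 : probability Omega R)
  (Ph Lh Pz Lz Lch N K M : nat)
  (hLch : Lch = maxn Lz Lh)
  (hPhN : (Ph %| N)%N) (hPzN : (Pz %| N)%N) (hN : (Lch < N)%N)
  (hK : K = (N - Lch)%N) (hLsw : (Lch + 1 < K * M)%N)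
  (h : int -> int -> R[i])
  (h_periodic : forall m l : int, h (m + Ph%:Z) l = h m l)
  (h_support : forall m l : int, l < 0 \/ Lh%:Z < l -> h m l = 0)
  (cz : int -> int -> R[i])
  (cz_periodic : forall m l : int, cz (m + Pz%:Z) l = cz m l)
  (cz_support : forall m l : int, Lz%:Z < `|l| -> cz m l = 0)
  (cz_invertible : noise_matrix K cz \in unitmx)
  (Ns : nat) (s : Ns.-tuple R[i]) (Ns_gt0 : (0 < Ns)%N) (s_distinct : uniq s)
  (fsw : 'cV[R[i]]_(M * K))
  (S Z : int -> Omega -> R[i])
  (S_measurable : forall k, measurable_fun setT (S k))
  (Z_measurable : forall k, measurable_fun setT (Z k))
  (noise0 : proper_gaussian_noise P0 cz Z)
  (noise1 : proper_gaussian_noise P1 cz Z)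
  (n : int)
  (H0 : data_hypothesis N M n P0 s S Z)
  (H1 : sync_hypothesis N Lch n P1 s fsw S Z) :
  let RP : Omega -> 'cV[R[i]]_(M * K) := post_processed N M K Lch n h S Z in
  let quotient (r : 'cV[R[i]]_(M * K)) : R :=
    data_sum N Lch s h cz r / sync_sum N Lch s h cz fsw r in
  let likelihood_ratio_test (f0 f1 : 'cV[R[i]]_(M * K) -> R) r : Prop :=
    f0 r / f1 r = ((Ns ^ (M * K))%:R)^-1 * quotient r /\
    forall lambda : R, 0 < lambda ->
      (lambda < f0 r / f1 r <->
         ln (lambda * (Ns ^ (M * K))%:R) < ln (quotient r)) /\
      (f0 r / f1 r < lambda <->
         ln (quotient r) < ln (lambda * (Ns ^ (M * K))%:R)) in
  [/\ forall v : 'cV[R[i]]_K,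
        complex.Im (inverse_form (noise_matrix K cz) v) = 0,
      exists f0 f1 : 'cV[R[i]]_(M * K) -> R,
        [/\ is_density P0 RP f0, is_density P1 RP f1 &
            forall r, likelihood_ratio_test f0 f1 r] &
      forall f0 f1 : 'cV[R[i]]_(M * K) -> R,
        is_density P0 RP f0 -> is_density P1 RP f1 ->
        {ae lebesgue_cV R (M * K), forall r, likelihood_ratio_test f0 f1 r}].
Proof.
move=> RP quotient test.
have hLz : (Lz <= Lch)%N by rewrite hLch leq_maxl.
have dens0 := data_hypothesis_density hLz hPhN hPzN hN hK h_periodic cz_periodic
  cz_support cz_invertible (s := s) _ s_distinct S_measurable Z_measurable
    noise0 H0.
have dens1 := sync_hypothesis_density hLz hPhN hPzN hN hK h_periodic cz_periodic
  cz_support cz_invertible (s := s) _ s_distinct S_measurable Z_measurable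
    noise1 H1.
(* The constant [noise_mass] is literally the same in [dens0] and [dens1]; its positivity allows it
   to be cancelled. *)
have [mass_gt0 _] := noise_vector_density M n hLz hN hK hPzN cz_periodic
  cz_support cz_invertible Z_measurable noise0.
move: dens0 dens1; rewrite size_tuple => /(_ Ns_gt0) dens0 /(_ Ns_gt0) dens1.
set f0 := fun r => _ in dens0; set f1 := fun r => _ in dens1.
have Npow_gt0 e : 0 < ((Ns ^ e)%:R : R) by rewrite ltr0n expn_gt0 Ns_gt0.
have sum_gt0 p (F : 'I_p -> R) : (0 < p)%N -> (forall l, 0 < F l) ->
  0 < \sum_l F l.
  case: p F => // p F _ F0; rewrite big_ord_recl ltr_pwDl// sumr_ge0// => l _.
  exact: ltW.
have data_gt0 (r : 'cV[R[i]]_(M * K)) : 0 < data_sum N Lch s h cz r.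
  by apply: sum_gt0 => [|l]; rewrite ?expR_gt0// size_tuple expn_gt0 Ns_gt0.
have sync_gt0 r : 0 < sync_sum N Lch s h cz fsw r.
  by apply: sum_gt0 => [|l]; rewrite ?expR_gt0// size_tuple expn_gt0 Ns_gt0.
have ratioE r : f0 r / f1 r = ((Ns ^ (M * K))%:R)^-1 * quotient r.
  (* The counts [Ns ^ (M * N)] and [Ns ^ (M * Lch)] differ by exactly the factor [Ns ^ (M * K)]. *)
  have MN : (M * N = M * K + M * Lch)%N by rewrite -mulnDr hK subnK// ltnW.
  rewrite /f0 /f1 /quotient MN expnD natrM.
  have := Npow_gt0 (M * K)%N; have := Npow_gt0 (M * Lch)%N.
  have := data_gt0 r; have := sync_gt0 r; move: mass_gt0.
  by move=> /gt_eqF a1 /gt_eqF a2 /gt_eqF a3 /gt_eqF a4 /gt_eqF a5; field;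
    rewrite a1 a2 a4 a5.
(* The test sees the densities only through their ratio at [r], so one argument serves both the
   explicit and the arbitrary versions; [ln] preserves strict order because both arguments are
   positive. *)
have test_of_ratio g0 g1 r : g0 r / g1 r = f0 r / f1 r -> test g0 g1 r.
  move=> gE; rewrite /test gE ratioE; split=> // lambda lambda_gt0.
  have q0 : 0 < quotient r by rewrite divr_gt0.
  have N0 := Npow_gt0 (M * K)%N.
  have lN0 : 0 < lambda * (Ns ^ (M * K))%:R by rewrite mulr_gt0.
  by rewrite !ltr_ln ?posrE// mulrC ltr_pdivlMr// ltr_pdivrMr.
split.
- move=> v; apply: hermitian_inverse_form_real.
  exact: (noise_matrix_hermitian (P := P0) K Z_measurable noise0).
- by exists f0, f1; split=> // r; exact: test_of_ratio.
- move=> g0 g1 dg0 dg1.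
  have ae0 := density_ae_unique dg0 dens0.
  have ae1 := density_ae_unique dg1 dens1.
  apply: filterS2 ae0 ae1 => r e0 e1; apply: test_of_ratio.
  by rewrite e0 e1.
Qed.
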